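(* For every constant $c>0$ there is a constant $C>0$ (depending on $c$ only) such that the following holds. Let $d\ge1$ and $n\ge 1$ be integers, let $\beta\ge 1+c$ be real, let $\theta^\star\in S^{d-1}$, and let $\epsilon,\delta\in(0,1)$. Let $(\mathbf{x}_1,\mathbf{y}_1),\dots,(\mathbf{x}_n,\mathbf{y}_n)$ be i.i.d. from the logistic regression model with parameter $\theta^\star$ and inverse temperature $\beta$, and let $\hat\theta_{\mathrm{relu}}$ be an empirical ReLU risk minimizer, i.e. $$\hat\theta_{\mathrm{relu}}\in\arg\min_{\theta\in S^{d-1}}\frac1n\sum_{i=1}^n[-\mathbf{y}_i\mathbf{x}_i^{\top}\theta]_+.$$ If $$n\ \ge\ C\left(\frac{d\log(d/\epsilon)+\log(1/\delta)}{\beta\epsilon^2}+\frac{d\log(d/\epsilon)+\log(1/\delta)}{\epsilon}\right),$$ then with probability at least $1-\delta$ we have $\|\hat\theta_{\mathrm{relu}}-\theta^\star\|\le\epsilon$.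
   Context: $\|\cdot\|$ is the Euclidean norm on $\mathbb{R}^d$, $S^{d-1}=\{\theta\in\mathbb{R}^d:\|\theta\|=1\}$, $[x]_+=\max\{0,x\}$, and $\log$ is the natural logarithm. Logistic regression model with parameter $\theta\in S^{d-1}$ and inverse temperature $\beta$: $\mathbf{x}\sim N(0,I_d)$ is a standard normal vector in $\mathbb{R}^d$ and, conditionally on $\mathbf{x}$, $\mathbf{y}\in\{-1,1\}$ equals $1$ with probability $g'(\beta\,\mathbf{x}^{\top}\theta)$, where $g'(\eta)=1/(1+e^{-\eta})$. The estimator $\hat\theta_{\mathrm{relu}}$ is any measurable selection of a minimizer. *)

(* Defs.v *)
From HB Require Import structures.
From mathcomp Require Import all_boot all_order all_algebra.
From mathcomp Require Import all_classical all_reals all_analysis.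

Set Implicit Arguments.
Unset Strict Implicit.
Unset Printing Implicit Defensive.

Import Order.TTheory GRing.Theory Num.Theory.
Import numFieldNormedType.Exports.

Local Open Scope classical_set_scope.
Local Open Scope ring_scope.

Definition measure_rV_display : measure_display -> measure_display.
Proof. exact. Qed.

(* Row vectors carry the product sigma-algebra, i.e. the one generated by the
   coordinate maps; on 'rV[R]_n this is the Borel sigma-algebra of R^n.  The
   construction is the same as the library's for n.-tuple T. *)
Section measurable_rV.
Context {disp : measure_display} {T : measurableType disp}.
Variable n : nat.

Let coors : 'I_n -> 'rV[T]_n -> T := fun i v => v ord0 i.

Let rV_set0 : g_sigma_preimage coors set0.
Proof. exact: sigma_algebra0. Qed.

Let rV_setC A : g_sigma_preimage coors A -> g_sigma_preimage coors (~` A).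
Proof. exact: sigma_algebraC. Qed.

Let rV_bigcup (F : (set 'rV[T]_n)^nat) :
  (forall i, g_sigma_preimage coors (F i)) ->
  g_sigma_preimage coors (\bigcup_i (F i)).
Proof. exact: sigma_algebra_bigcup. Qed.

HB.instance Definition _ := @isMeasurable.Build (measure_rV_display disp)
  'rV[T]_n (g_sigma_preimage coors) rV_set0 rV_setC rV_bigcup.

End measurable_rV.

Definition dot (R : realType) (d : nat) (u v : 'rV[R]_d) : R :=
  \sum_(j < d) u ord0 j * v ord0 j.

(* The library's norm `|v| on 'rV[R]_d is the sup norm, hence enorm. *)
Definition enorm (R : realType) (d : nat) (u : 'rV[R]_d) : R :=
  Num.sqrt (dot u u).

Definition unit_sphere (R : realType) (d : nat) : set 'rV[R]_d :=
  [set u | enorm u = 1].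
Arguments unit_sphere R d : clear implicits.

Definition mutually_independent (R : realType) (dO dT : measure_display)
    (Omega : measurableType dO) (T : measurableType dT)
    (P : probability Omega R) (I : finType) (Z : I -> Omega -> T) : Prop :=
  forall (J : {set I}) (A : I -> set T), (forall i, measurable (A i)) ->
    P [set w | forall i, i \in J -> A i (Z i w)] =
    (\prod_(i in J) P [set w | A i (Z i w)])%E.

Definition standard_normal_vector (R : realType) (dO : measure_display)
    (Omega : measurableType dO) (P : probability Omega R) (d : nat)
    (X : Omega -> 'rV[R]_d) : Prop :=
  mutually_independent P (fun (j : 'I_d) (w : Omega) => X w ord0 j) /\
  forall (j : 'I_d) (A : set R), measurable A ->
    P [set w | A (X w ord0 j)] = normal_prob 0 1 A.

Definition sigmoid (R : realType) (eta : R) : R := 1 / (1 + expR (- eta)).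

(* The last clause says that sigmoid (beta * X^T theta) is a version of the
   conditional probability P(Y = 1 | X). *)
Definition logistic_model (R : realType) (dO : measure_display)
    (Omega : measurableType dO) (P : probability Omega R) (d : nat)
    (beta : R) (theta : 'rV[R]_d)
    (X : Omega -> 'rV[R]_d) (Y : Omega -> R) : Prop :=
  [/\ standard_normal_vector P X,
      forall w, Y w = 1 \/ Y w = - 1 &
      forall A : set 'rV[R]_d, measurable A ->
        P [set w | A (X w) /\ Y w = 1] =
        (\int[P]_(w in X @^-1` A) (sigmoid (beta * dot (X w) theta))%:E)%E].

(* All pairs (X i, Y i) follow the model with the same parameters, so
   independence is all that remains for the sample to be i.i.d. *)
Definition logistic_sample (R : realType) (dO : measure_display)
    (Omega : measurableType dO) (P : probability Omega R) (d n : nat)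
    (beta : R) (theta : 'rV[R]_d)
    (X : 'I_n -> Omega -> 'rV[R]_d) (Y : 'I_n -> Omega -> R) : Prop :=
  mutually_independent P (fun (i : 'I_n) (w : Omega) => (X i w, Y i w)) /\
  forall i : 'I_n, logistic_model P beta theta (X i) (Y i).

Definition relu_risk (R : realType) (d n : nat)
    (x : 'I_n -> 'rV[R]_d) (y : 'I_n -> R) (theta : 'rV[R]_d) : R :=
  n%:R^-1 * \sum_(i < n) Num.max 0 (- y i * dot (x i) theta).

Definition argmin (R : realType) (T : Type) (D : set T) (f : T -> R) : set T :=
  [set t | D t /\ forall t', D t' -> f t <= f t'].

(* Main.v *)
Require Import Defs.
From HB Require Import structures.
From mathcomp Require Import all_boot all_order all_algebra.
From mathcomp Require Import all_classical all_reals all_analysis.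
From mathcomp Require Import measurable_realfun ring lra.

(** Write u = <x, theta_star>, v = <x, theta>, rho = <theta_star, theta> and
    r = |theta - theta_star|, so that r^2 = 2 (1 - rho).  The empirical risk
    difference between theta and theta_star is the average of the excess losses
    D = max(0, - y v) - max(0, - y u), and a minimizer makes this average
    nonpositive.  Everything rests on a comparison of the mean of D with its
    fluctuations.

    Mean.  As max(0, - y t) = (|t| - y t) / 2 and |u|, |v| have the same law, the
    mean of D is E[y (u - v)] / 2 = (1 - rho) / 2 * E[T(beta u) u], where
    T(t) = sigmoid t - sigmoid (- t), so that T(beta u) is the conditional mean of
    the label.  Hence it is at least signal_gap * r^2 / 4 ([bias_mean], [bias_cross_mean]).

    Fluctuations.  D vanishes unless the label contradicts the sign of u, which
    has conditional probability at most exp(- beta |u|), or u and v have opposite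
    signs, which forces |u| to be of order r.  The first event contributes
    r^2 / beta and the second r^3 to the second moment ([excess_expR_le],
    [second_order_mean]).  Consequently, for a tilt l of order
    1 / (1 / beta + r), E exp(- l D) <= exp(- c l r^2) ([excess_mgf_le]), and
    l r^2 is bounded below by a multiple of 1 / (1 / (beta eps^2) + 1 / eps)
    whenever r >= eps.  A Chernoff bound for the independent sample then shows
    that one fixed theta at distance at least eps beats the margin
    signal_gap * eps^2 / 16 except with probability exponentially small in n
    times this rate ([excess_sum_le]).

    Uniformity.  The excess loss is Lipschitz in theta for the sup norm, with
    constant the l1 norm of x, whose average is at most 3 d except with
    probability exp(- n d) ([l1norm_sum_tail]).  A grid of mesh of order
    eps^2 / d therefore suffices; it has (C d / eps^2)^d cells, and the logarithm
    of this number is O(d log (d / eps)) once d >= 2 ([failure_prob_le],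
    [failure_le]).  For d = 1 the quantity d log (d / eps) can be arbitrarily
    small and would not absorb the constants of a union bound, but the antipode
    of theta_star is then the only competitor ([failure_prob_le_dim1]).

    Gaussian input.  The computations above use that (u, v) has the law of
    (u, rho u + sqrt (1 - rho^2) z) for independent standard normal u and z
    ([gaussian_projections]).  Since a standard normal vector is given by the law
    of its coordinates, this needs rotation invariance: a planar rotation is a
    product of three shears, each of which preserves Lebesgue measure by Fubini
    and translation invariance ([ge0_integral_rotation]), so Givens rotations
    preserve standard normal vectors ([standard_normal_givens]), and finitely
    many of them move theta_star and theta into the first two coordinates. *)

Set Implicit Arguments.
Unset Strict Implicit.
Unset Printing Implicit Defensive.

Import Order.TTheory GRing.Theory Num.Theory.
Import numFieldNormedType.Exports.

Local Open Scope classical_set_scope.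
Local Open Scope ring_scope.

(** * Integrals against weighted image measures *)

Section weighted.
Context d1 d2 (S : measurableType d1) (T : measurableType d2) (R : realType).
Variables (mu : {measure set S -> \bar R}) (Z : S -> T).
Hypothesis mZ : measurable_fun setT Z.
Import HBNNSimple.
Local Open Scope ereal_scope.

(** The right-hand side depends on W, Z and mu only through the integrals of W
    over the preimages under Z, which is what makes transfer between different
    spaces possible. *)
Lemma integral_weighted_lim (W : S -> R) (f : T -> \bar R) (mf : measurable_fun [set: T] f) :
  measurable_fun [set: S] W -> (forall w, (0 <= W w)%R) -> (forall t, 0 <= f t) ->
  \int[mu]_w ((W w)%:E * f (Z w)) =
  limn (fun n => \sum_(k \in range (nnsfun_approx measurableT mf n))
    (k%:E * \int[mu]_(w in Z @^-1` (nnsfun_approx measurableT mf n @^-1` [set k])) (W w)%:E)).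
Proof.
move=> mW W0 f0; set g := nnsfun_approx measurableT mf.
transitivity (limn (fun n => \int[mu]_w ((W w)%:E * (g n (Z w))%:E))).
  rewrite -monotone_convergence//.
  - apply: eq_integral => w _; apply/esym/cvg_lim => //.
    apply: cvgeZl => //; first exact: cvg_nnsfun_approx.
  - move=> n; apply: emeasurable_funM; apply/measurable_EFinP => //.
    exact: measurableT_comp.
  - by move=> n w _; rewrite mule_ge0// lee_fin.
  - move=> w _ m n mn; rewrite lee_wpmul2l ?lee_fin//.
    exact/lefP/nd_nnsfun_approx.
congr (limn _); apply/funext => n.
have mpre k : measurable (Z @^-1` (g n @^-1` [set k])).
  by rewrite -[X in measurable X]setTI; apply: mZ.
have ind_ge0 k w : 0 <= (k * \1_(Z @^-1` (g n @^-1` [set k])) w)%:E.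
  exact: (nnfun_muleindic_ge0 (g n) k (Z w)).
transitivity (\int[mu]_w \sum_(k \in range (g n))
    (k * \1_(Z @^-1` (g n @^-1` [set k])) w)%:E * (W w)%:E).
  apply: eq_integral => w _.
  rewrite -ge0_mule_fsuml; last by [].
  by rewrite muleC [X in X%:E * _]fimfunE -fsumEFin.
rewrite ge0_integral_fsum//; last 2 first.
- move=> k; apply: emeasurable_funM; apply/measurable_EFinP => //.
  by apply: measurable_funM => //; exact: measurable_indic.
- by move=> k w _; rewrite mule_ge0// lee_fin.
apply: eq_fsbigr => k /set_mem [t _ tk].
under eq_integral do rewrite EFinM -muleA.
rewrite ge0_integralZl//.
- congr (_ * _); rewrite [RHS]integral_mkcond; apply: eq_integral => w _.
  by rewrite patchE indicE; case: ifPn => _; rewrite ?mul1e ?mul0e.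
- by apply: emeasurable_funM; apply/measurable_EFinP => //; exact: measurable_indic.
- by move=> w _; rewrite mule_ge0// lee_fin.
- by rewrite lee_fin -tk.
Qed.

End weighted.

Section transfer.
Import HBNNSimple.

(** Two weighted maps, possibly from different measure spaces, that induce the
    same measure on T integrate every nonnegative function alike.  With suitable
    weights this single principle yields the product rule for independent
    variables, the passage from a law to its density, and the replacement of the
    label indicator by its conditional probability. *)
Lemma integral_weighted_transfer d1 d2 d3 (S : measurableType d1)
    (S' : measurableType d2) (T : measurableType d3) (R : realType)
    (mu : {measure set S -> \bar R}) (mu' : {measure set S' -> \bar R})
    (Z : S -> T) (Z' : S' -> T) (W : S -> R) (W' : S' -> R) (f : T -> \bar R) :
  measurable_fun setT Z -> measurable_fun setT Z' ->
  measurable_fun setT W -> measurable_fun setT W' -> measurable_fun [set: T] f ->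
  (forall w, 0 <= W w) -> (forall w, 0 <= W' w) -> (forall t, 0 <= f t)%E ->
  (forall A, measurable A ->
    \int[mu]_(w in Z @^-1` A) (W w)%:E = \int[mu']_(w in Z' @^-1` A) (W' w)%:E)%E ->
  (\int[mu]_w ((W w)%:E * f (Z w)) = \int[mu']_w ((W' w)%:E * f (Z' w)))%E.
Proof.
move=> mZ mZ' mW mW' mf W0 W'0 f0 WW'.
rewrite (integral_weighted_lim mu mZ mf mW W0 f0).
rewrite (integral_weighted_lim mu' mZ' mf mW' W'0 f0).
congr (limn _); apply/funext => n.
by apply: eq_fsbigr => k _; rewrite WW'.
Qed.

End transfer.

Lemma integral_weighted_transferR d1 d2 d3 (S : measurableType d1)
    (S' : measurableType d2) (T : measurableType d3) (R : realType)
    (mu : {measure set S -> \bar R}) (mu' : {measure set S' -> \bar R})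
    (Z : S -> T) (Z' : S' -> T) (W : S -> R) (W' : S' -> R) (f : T -> R) :
  measurable_fun setT Z -> measurable_fun setT Z' ->
  measurable_fun setT W -> measurable_fun setT W' -> measurable_fun setT f ->
  (forall w, 0 <= W w) -> (forall w, 0 <= W' w) -> (forall t, 0 <= f t) ->
  (forall A, measurable A ->
    \int[mu]_(w in Z @^-1` A) (W w)%:E = \int[mu']_(w in Z' @^-1` A) (W' w)%:E)%E ->
  (\int[mu]_w (W w * f (Z w))%:E = \int[mu']_w (W' w * f (Z' w))%:E)%E.
Proof.
move=> mZ mZ' mW mW' mf W0 W'0 f0 WW'.
apply: (@integral_weighted_transfer _ _ _ _ _ _ _ mu mu' Z Z' W W' (EFin \o f)) => //.
exact/measurable_EFinP.
Qed.

(** * Product rule for independent variables *)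

Section independence.
Context (dO dT : measure_display) (Omega : measurableType dO) (T : measurableType dT) (R : realType).
Variables (P : probability Omega R) (I : finType) (Z : I -> Omega -> T).
Hypothesis mZ : forall i, measurable_fun setT (Z i).
Hypothesis indZ : mutually_independent P Z.
Local Open Scope ereal_scope.

Let mpre i (A : set T) : measurable A -> measurable (Z i @^-1` A).
Proof. by move=> mA; rewrite -[X in measurable X]setTI; exact: mZ. Qed.

Let integral_indic_comp i (A : set T) : measurable A ->
  \int[P]_w (\1_A (Z i w))%:E = P [set w | A (Z i w)].
Proof.
move=> mA; rewrite -[RHS]/(P (Z i @^-1` A)) -[X in P X]setIT.
by rewrite -integral_indic//; exact: mpre.
Qed.

Let indep_indic (A : I -> set T) : (forall i, measurable (A i)) ->
  \int[P]_w (\prod_i \1_(A i) (Z i w))%R%:E = \prod_i \int[P]_w (\1_(A i) (Z i w))%:E.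
Proof.
move=> mA.
set E := [set w | forall i, i \in [set: I]%SET -> A i (Z i w)].
have mE : measurable E.
  have -> : E = \big[setI/setT]_(i : I) (Z i @^-1` A i).
    rewrite -bigcap_seq; apply/seteqP; split=> w /= Ew i _.
      by apply: Ew; rewrite ?finset.in_setT.
    by apply: Ew; rewrite /= mem_index_enum.
  by apply: bigsetI_measurable => i _; exact: mpre.
transitivity (P E).
  rewrite -[X in P X]setIT -integral_indic//; apply: eq_integral => w _.
  congr (_%:E); rewrite indicE; case: (boolP (w \in E)) => [/set_mem Ew|/negP Ew].
    rewrite big1// => i _; rewrite indicE mem_set//; apply: Ew.
    by rewrite ?finset.in_setT.
  have [i Ai] : exists i, ~ A i (Z i w).
    by apply/existsNP => AZ; apply: Ew; apply/mem_set => i _; exact: AZ.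
  by rewrite (bigD1 i)//= indicE memNset// mul0r.
rewrite /E indZ//.
apply: eq_big => [i|i _]; first by rewrite ?finset.in_setT.
by rewrite integral_indic_comp.
Qed.

(** The definition of independence covers products of indicators.  The factors
    that are not yet indicators are exchanged one at a time: with all others
    frozen into a weight, the product rule with an indicator in place of that
    factor says that the weight and a constant induce the same measure. *)
Lemma independent_integral_prod (f : I -> T -> R) :
  (forall i, measurable_fun setT (f i)) -> (forall i t, (0 <= f i t)%R) ->
  (forall i, \int[P]_w (f i (Z i w))%:E < +oo) ->
  \int[P]_w (\prod_i f i (Z i w))%R%:E = \prod_i \int[P]_w (f i (Z i w))%:E.
Proof.
move=> mf f0 foo.
have : forall i, i \notin [set: I]%SET -> exists2 A, measurable A & f i = \1_A.
  by move=> i; rewrite finset.in_setT.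
have [k] := ubnP #|[set: I]%SET|.
(* J contains the indices whose factor need not be an indicator. *)
elim: k [set: I]%SET f mf f0 foo => // k IH J f mf f0 foo Jk fJ.
have [J0|[j jJ]] := set_0Vmem J.
  have fA i : exists2 A, measurable A & f i = \1_A by apply: fJ; rewrite J0 inE.
  have [A A_] := choice (fun i => let: ex_intro2 A mA fA := fA i in
     ex_intro (fun A => measurable A /\ f i = \1_A) A (conj mA fA)).
  have -> : f = fun i => \1_(A i) by apply/funext => i; case: (A_ i).
  by apply: indep_indic => i; case: (A_ i).
pose g (A : set T) i := if i == j then \1_A else f i : T -> R.
have mg A i : measurable A -> measurable_fun setT (g A i).
  by move=> mA; rewrite /g; case: eqP => // _; exact: measurable_indic.
have g0 A i t : (0 <= g A i t)%R by rewrite /g; case: eqP => // _; rewrite indicE.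
pose W w := (\prod_(i | i != j) f i (Z i w))%R.
have W0 w : (0 <= W w)%R by apply: prodr_ge0.
have mW : measurable_fun setT W.
  have -> : W = fun w => (\prod_i (if i != j then f i (Z i w) else 1))%R.
    by apply/funext => w; rewrite /W big_mkcond.
  apply: measurable_prod => i _; case: (i != j) => /=; last exact: measurable_cst.
  exact: measurableT_comp.
have Ej i : \int[P]_w (f i (Z i w))%:E \is a fin_num.
  by rewrite ge0_fin_numE// integral_ge0// => w _; rewrite lee_fin.
pose K := fine (\prod_(i | i != j) \int[P]_w (f i (Z i w))%:E).
have KE : K%:E = \prod_(i | i != j) \int[P]_w (f i (Z i w))%:E.
  by rewrite fineK// prode_fin_num// => i _.
have K0 : (0 <= K)%R.
  rewrite -lee_fin KE prode_ge0// => i _.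
  by apply: integral_ge0 => w _; rewrite lee_fin.
transitivity (\int[P]_w (W w * f j (Z j w))%:E).
  by apply: eq_integral => w _; rewrite (bigD1 j)//= mulrC.
have mfZ i : measurable_fun setT (fun w => (f i (Z i w))%:E).
  by apply/measurable_EFinP; exact: measurableT_comp.
rewrite (@integral_weighted_transferR _ _ _ _ _ _ _ P P (Z j) (Z j) W (cst K) (f j))//=.
- under eq_integral do rewrite EFinM.
  rewrite (bigD1 j)//= -KE muleC ge0_integralZl//.
  by move=> w _; rewrite lee_fin.
- move=> A mA; transitivity (\int[P]_w (\prod_i g A i (Z i w))%R%:E).
    rewrite integral_mkcond; apply: eq_integral => w _.
    rewrite (bigD1 j)//= {1}/g eqxx patchE indicE.
    rewrite -[w \in _]/(Z j w \in A).
    case: ifP => _; rewrite ?mul0r// mul1r; congr _%:E.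
    by apply: eq_bigr => i /negbTE ij; rewrite /g ij.
  rewrite (IH (J :\ j)%SET)//; first last.
  + move=> i; rewrite /g !inE negb_and negbK.
    by have [_ _|_ /fJ] := eqVneq i j; first by exists A.
  + by move: Jk; rewrite (cardsD1 j) jJ.
  + move=> i; rewrite /g; case: eqP => // _; rewrite integral_indic_comp//.
    by rewrite (le_lt_trans (probability_le1 _ _)) ?ltry//; exact: mpre.
  + by move=> i; exact: mg.
  rewrite (bigD1 j)//= {1}/g eqxx integral_indic_comp//.
  rewrite integral_cst ?KE; last exact: mpre.
  rewrite muleC; congr (_ * _).
  by apply: eq_bigr => i /negbTE ij; rewrite /g ij.
Qed.

End independence.

(** * Rotation invariance of planar Lebesgue and Gaussian measure *)

Section rotation.
Variable R : realType.
Notation mu := (@lebesgue_measure R).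

Lemma lebesgue_measure_translation (a : R) (A : set R) : measurable A ->
  pushforward mu ((fun x => x + a) : _ -> measurableTypeR R) A = mu A.
Proof.
have ma : measurable_fun [set: measurableTypeR R] ((fun x => x + a) : _ -> measurableTypeR R).
  exact: measurable_funD.
move=> mA; apply/esym/lebesgue_measure_unique => //= _ [[u v]] _ <-.
rewrite /pushforward/= (_ : _ @^-1` _ = `]u - a, v - a]%classic); last first.
  by apply/seteqP; split=> x /=; rewrite !in_itv/= ltrBlDr lerBrDr.
rewrite !lebesgue_measure_itv/= !lte_fin ltrD2r.
by case: ifP => // _; rewrite -!EFinB; congr _%:E; ring.
Qed.

Lemma ge0_integral_translation (a : R) (f : R -> R) :
  measurable_fun setT f -> (forall x, 0 <= f x) ->
  (\int[mu]_x (f (x + a))%:E = \int[mu]_x (f x)%:E)%E.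
Proof.
move=> mf f0.
have ma : measurable_fun [set: measurableTypeR R] ((fun x => x + a) : _ -> measurableTypeR R).
  exact: measurable_funD.
have /= <- := @ge0_integral_pushforward _ _ (measurableTypeR R) (measurableTypeR R) R
  _ ma mu setT (EFin \o f) measurableT.
- by apply: eq_measure_integral => //= A mA _; exact: lebesgue_measure_translation.
- exact/measurable_EFinP.
- by move=> x _; rewrite lee_fin.
Qed.

Let tonelli2 (h : R * R -> R) : measurable_fun setT h -> (forall z, 0 <= h z) ->
  (\int[mu \x mu]_z (h z)%:E = \int[mu]_y \int[mu]_x (h (x, y))%:E)%E.
Proof.
move=> mh h0; apply: (@fubini_tonelli2 _ _ (measurableTypeR R) (measurableTypeR R) R mu mu (EFin \o h)); first exact/measurable_EFinP.
by move=> z; rewrite lee_fin.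
Qed.

Lemma tonelli1 (h : R * R -> R) : measurable_fun setT h -> (forall z, 0 <= h z) ->
  (\int[mu \x mu]_z (h z)%:E = \int[mu]_x \int[mu]_y (h (x, y))%:E)%E.
Proof.
move=> mh h0; apply: (@fubini_tonelli1 _ _ (measurableTypeR R) (measurableTypeR R) R mu mu (EFin \o h)); first exact/measurable_EFinP.
by move=> z; rewrite lee_fin.
Qed.

Let shear1 (al : R) (h : R * R -> R) :
  measurable_fun setT h -> (forall z, 0 <= h z) ->
  (\int[mu \x mu]_z (h (z.1 + al * z.2, z.2))%:E = \int[mu \x mu]_z (h z)%:E)%E.
Proof.
move=> mh h0.
have mS : measurable_fun setT (fun z : R * R => (z.1 + al * z.2, z.2)).
  apply: measurable_fun_pair => //; apply: measurable_funD => //.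
  exact: measurable_funM.
apply: (etrans (@tonelli2 _ (measurableT_comp mh mS) (fun=> h0 _))).
apply: etrans (esym (tonelli2 mh h0)).
apply: eq_integral => y _.
rewrite /= (@ge0_integral_translation (al * y) (fun x => h (x, y)))//.
exact: measurableT_comp.
Qed.

Let shear2 (al : R) (h : R * R -> R) :
  measurable_fun setT h -> (forall z, 0 <= h z) ->
  (\int[mu \x mu]_z (h (z.1, z.2 + al * z.1))%:E = \int[mu \x mu]_z (h z)%:E)%E.
Proof.
move=> mh h0.
have mS : measurable_fun setT (fun z : R * R => (z.1, z.2 + al * z.1)).
  apply: measurable_fun_pair => //; apply: measurable_funD => //.
  exact: measurable_funM.
apply: (etrans (@tonelli1 _ (measurableT_comp mh mS) (fun=> h0 _))).
apply: etrans (esym (tonelli1 mh h0)).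
apply: eq_integral => x _.
rewrite /= (@ge0_integral_translation (al * x) (fun y => h (x, y)))//.
exact: measurableT_comp.
Qed.

(** A rotation is the product of a horizontal, a vertical and again a horizontal
    shear; s = 0 is excluded because the shear factor is (1 - c) / s. *)
Lemma ge0_integral_rotation (c s : R) (h : R * R -> R) :
  s != 0 -> c ^+ 2 + s ^+ 2 = 1 ->
  measurable_fun setT h -> (forall z, 0 <= h z) ->
  (\int[mu \x mu]_z (h (c * z.1 + s * z.2, - s * z.1 + c * z.2)%R)%:E =
   \int[mu \x mu]_z (h z)%:E)%E.
Proof.
move=> s0 cs1 mh h0; pose al := (1 - c) / s.
have mlin (a b : R) : measurable_fun setT (fun z : R * R => a * z.1 + b * z.2).
  by apply: measurable_funD; exact: measurable_funM.
have mS1 : measurable_fun setT (fun z : R * R => (z.1 + al * z.2, z.2)).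
  by apply: measurable_fun_pair => //; apply: measurable_funD => //; exact: measurable_funM.
have mS2 : measurable_fun setT (fun z : R * R => (z.1, z.2 + (- s) * z.1)).
  by apply: measurable_fun_pair => //; apply: measurable_funD => //; exact: measurable_funM.
(* The shears are peeled off from the innermost integrand outwards. *)
rewrite -(shear1 al mh h0).
rewrite -(@shear2 (- s) (fun z => h (z.1 + al * z.2, z.2)))//=; last exact: measurableT_comp.
rewrite -(@shear1 al (fun z => h (z.1 + al * (z.2 + - s * z.1), z.2 + - s * z.1)))//=.
  apply: eq_integral => -[x y] _ /=; congr (h (_, _))%:E.
    suff -> : x + al * y + al * (y + - s * (x + al * y)) =
       (1 - al * s) * x + (2 * al - al ^+ 2 * s) * y.
      congr (_ * x + _ * y); rewrite /al ?divfK//; first ring.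
      have -> : 2 * ((1 - c) / s) - ((1 - c) / s) ^+ 2 * s = (1 - c ^+ 2) / s by field.
      by rewrite -cs1 addrAC subrr add0r expr2 mulfK.
    by ring.
  have -> : y + - s * (x + al * y) = - s * x + (1 - al * s) * y by ring.
  by rewrite /al divfK//; ring.
apply: (measurableT_comp mh); apply: (measurableT_comp mS1 mS2).
Qed.

End rotation.

Section normal_law.
Variable R : realType.
Notation mu := (@lebesgue_measure R).
Notation N := (@normal_prob R 0 1).
Notation p := (@normal_pdf R 0 1).

Lemma normal_transfer d (T : measurableType d) (Q : {measure set T -> \bar R})
    (u : T -> R) (f : R -> \bar R) :
  measurable_fun setT u -> (forall A, measurable A -> Q [set w | A (u w)] = N A) ->
  measurable_fun [set: R] f -> (forall x, 0 <= f x)%E ->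
  (\int[Q]_w f (u w) = \int[mu]_x ((p x)%:E * f x))%E.
Proof.
move=> mu_ uN mf f0.
have := @integral_weighted_transfer _ _ _ _ (measurableTypeR R) R R Q mu u id (cst 1) p f.
move=> /(_ mu_ (@measurable_id _ _ _) (measurable_cst _) (measurable_normal_pdf 0 1) mf).
under eq_integral do rewrite mul1e.
apply => //.
- by move=> x; exact: normal_pdf_ge0.
- move=> A mA; rewrite -[RHS]/(N A) -uN//=.
  by rewrite integral_cst ?mul1e// -[X in measurable X]setTI; exact: mu_.
Qed.

Let mp : measurable_fun [set: R] p := measurable_normal_pdf 0 1.
Let p0 x : 0 <= p x := normal_pdf_ge0 0 1 x.

(** The product density depends on the squared radius only. *)
Lemma normal_pdfN01 x y : p x * p y = (@normal_peak R 1) ^+ 2 * expR (- (x ^+ 2 + y ^+ 2) / 2).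
Proof.
rewrite normal_pdfE ?oner_eq0// /normal_fun !subr0 expr1n.
rewrite mulrACA -expr2 -expRD; by congr (_ * expR _); field.
Qed.

Lemma ge0_integral_normal_prod (F : R * R -> R) :
  measurable_fun setT F -> (forall z, 0 <= F z) ->
  (\int[N \x N]_z (F z)%:E = \int[mu \x mu]_z (p z.1 * p z.2 * F z)%:E)%E.
Proof.
move=> mF F0.
rewrite tonelli1; last 2 first.
- by apply: measurable_funM => //; apply: measurable_funM; exact: measurableT_comp.
- by move=> z; rewrite !mulr_ge0.
rewrite (@fubini_tonelli1 _ _ (measurableTypeR R) (measurableTypeR R) R N N (EFin \o F)); last 2 first.
- exact/measurable_EFinP.
- by move=> z; rewrite lee_fin.
have mEF : measurable_fun [set: R * R] (EFin \o F) by exact/measurable_EFinP.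
have EF0 z : (0 <= (EFin \o F) z)%E by rewrite lee_fin.
have mFF := @measurable_fun_fubini_tonelli_F _ _ (measurableTypeR R) (measurableTypeR R) R N (EFin \o F) mEF EF0.
rewrite (@normal_transfer _ _ N id (fubini_F N (EFin \o F)))//; last first.
  by move=> x; exact: integral_ge0.
apply: eq_integral => x _.
rewrite /fubini_F /= (@normal_transfer _ _ N id (fun y => (F (x, y))%:E))//.
- rewrite -ge0_integralZl//.
  + by apply: eq_integral => y _; rewrite -!EFinM mulrA.
  + by apply/measurable_EFinP; apply: measurable_funM => //; exact: measurableT_comp.
  + by move=> y _; rewrite -EFinM lee_fin mulr_ge0.
  + by rewrite lee_fin.
- by apply/measurable_EFinP; exact: measurableT_comp.
- by move=> y; rewrite lee_fin.
Qed.

Lemma normal_prod_rotation (c s : R) (F : R * R -> R) :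
  s != 0 -> c ^+ 2 + s ^+ 2 = 1 ->
  measurable_fun setT F -> (forall z, 0 <= F z) ->
  (\int[N \x N]_z (F (c * z.1 + s * z.2, - s * z.1 + c * z.2)%R)%:E =
   \int[N \x N]_z (F z)%:E)%E.
Proof.
move=> s0 cs1 mF F0.
have mlin (a b : R) : measurable_fun setT (fun z : R * R => a * z.1 + b * z.2).
  by apply: measurable_funD; exact: measurable_funM.
have mG : measurable_fun setT (fun z : R * R => p z.1 * p z.2 * F z).
  by apply: measurable_funM => //; apply: measurable_funM; exact: measurableT_comp.
have G0 z : 0 <= p z.1 * p z.2 * F z by rewrite !mulr_ge0.
have mrot : measurable_fun setT (fun z : R * R => (c * z.1 + s * z.2, - s * z.1 + c * z.2)).
  exact: measurable_fun_pair.
have mFrot := measurableT_comp mF mrot.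
apply: (etrans (@ge0_integral_normal_prod _ mFrot _)) => [z|]; first exact: F0.
apply: etrans (esym (ge0_integral_normal_prod mF F0)).
apply: etrans (ge0_integral_rotation s0 cs1 mG G0).
apply: eq_integral => -[x y] _ /=.
suff -> : p x * p y = p (c * x + s * y) * p (- s * x + c * y) by [].
rewrite !normal_pdfN01.
suff -> : x ^+ 2 + y ^+ 2 = (c * x + s * y) ^+ 2 + (- s * x + c * y) ^+ 2 by [].
transitivity ((c ^+ 2 + s ^+ 2) * (x ^+ 2 + y ^+ 2)); last by ring.
by rewrite cs1 mul1r.
Qed.

Lemma normal_prod_rotation_set (c s : R) (A B : set R) :
  s != 0 -> c ^+ 2 + s ^+ 2 = 1 -> measurable A -> measurable B ->
  ((N \x N) [set z | A (c * z.1 + s * z.2)%R /\ B (- s * z.1 + c * z.2)%R] = N A * N B)%E.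
Proof.
move=> s0 cs1 mA mB.
pose S : set (R * R) := [set z | A (c * z.1 + s * z.2) /\ B (- s * z.1 + c * z.2)].
have mlin (a b : R) : measurable_fun setT (fun z : R * R => a * z.1 + b * z.2).
  by apply: measurable_funD; exact: measurable_funM.
have mS : measurable S.
  rewrite (_ : S = (fun z : R * R => c * z.1 + s * z.2) @^-1` A `&`
     (fun z : R * R => - s * z.1 + c * z.2) @^-1` B)//.
  by apply: measurableI; rewrite -[X in measurable X]setTI; exact: mlin.
have mAB : measurable (A `*` B) by exact: measurableX.
have EI (V : set (R * R)) : measurable V -> (\int[N \x N]_z (\1_V z)%:E = (N \x N) V)%E.
  move=> mV; rewrite -[in RHS](setIT V).
  exact: (@integral_indic _ (measurableTypeR R * measurableTypeR R)%type R (N \x N)%E setT measurableT V mV).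
rewrite -(@product_measure1E _ _ (measurableTypeR R) (measurableTypeR R) R N N A B mA mB).
rewrite -[LHS]/((N \x N)%E S).
apply: etrans (esym (EI _ mS)) _.
apply: etrans (EI _ mAB).
exact: (normal_prod_rotation s0 cs1 (@measurable_indic _ _ R setT _ mAB)).
Qed.

End normal_law.

(** * Standard normal vectors and Givens rotations *)

(** Uniqueness of the product measure, for a pair observed on an event E of
    probability K that is independent of it.  When K = 0 there is nothing to
    normalize, and both sides vanish. *)
Lemma weighted_product_law d1 d2 dO (T1 : measurableType d1) (T2 : measurableType d2)
    (Omega : measurableType dO) (R : realType) (P : probability Omega R)
    (m1 : {sigma_finite_measure set T1 -> \bar R})
    (m2 : {sigma_finite_measure set T2 -> \bar R})
    (f : Omega -> T1 * T2) (E : set Omega) (K : R) (S : set (T1 * T2)) :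
  measurable_fun setT f -> measurable E -> 0 <= K ->
  (forall A B, measurable A -> measurable B ->
     P (f @^-1` (A `*` B) `&` E) = m1 A * m2 B * K%:E)%E ->
  P E = K%:E -> measurable S ->
  (P (f @^-1` S `&` E) = (m1 \x m2) S * K%:E)%E.
Proof.
move=> mf mE K0 rect PE mS.
have mpre A : measurable A -> measurable (f @^-1` A).
  by move=> mA; rewrite -[X in measurable X]setTI; exact: mf.
have [K00|Kn0] := eqVneq K 0.
  have PE0 : P E = 0%E by rewrite PE K00.
  rewrite K00 mule0; apply/eqP; rewrite eq_le measure_ge0 andbT -PE0.
  apply: le_measure; rewrite ?inE.
  - by apply: measurableI => //; exact: mpre.
  - exact: mE.
  - exact: subIsetr.
have Ki0 : 0 <= K^-1 by rewrite invr_ge0.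
have [nu nuE] : exists nu : {measure set (T1 * T2)%type -> \bar R},
    forall A, nu A = (K^-1%:E * P (f @^-1` A `&` E))%E.
  unshelve eexists (mscale (NngNum Ki0) (pushforward (mrestr P mE) f) : {measure set _ -> \bar R}).
    exact: mf.
  by [].
have KK : (K^-1%:E * K%:E = 1)%E by rewrite -EFinM mulVf.
rewrite (@product_measure_unique _ _ _ _ _ m1 m2 nu)//.
  by rewrite nuE muleAC KK mul1e.
by move=> A B mA mB; rewrite nuE rect// muleCA KK mule1.
Qed.

Section rV_measurable.
Context (R : realType) (dO : measure_display) (Omega : measurableType dO) (d : nat).

Lemma measurable_coord (j : 'I_d) :
  measurable_fun [set: 'rV[R]_d] (fun v : 'rV[R]_d => v ord0 j).
Proof.
move=> _ B mB; rewrite setTI; apply: sub_sigma_algebra => /=.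
rewrite -bigcup_seq/=; exists j => /=; first by rewrite mem_index_enum.
by exists B => //; rewrite setTI.
Qed.

(** The sigma-algebra on row vectors is generated by the coordinates. *)
Lemma measurable_rVP (X : Omega -> 'rV[R]_d) :
  (forall j, measurable_fun setT (fun w => X w ord0 j)) -> measurable_fun setT X.
Proof.
move=> mX _ A mA; rewrite setTI.
suff : image_set_system setT X measurable A by rewrite /image_set_system/= setTI.
move: A mA; apply: smallest_sub; first exact/sigma_algebra_image/sigma_algebra_measurable.
rewrite -bigcup_seq; apply: bigcup_sub => j _ _ [B mB <-].
by rewrite /image_set_system/= !setTI -[X in measurable X]setTI; exact: mX.
Qed.

End rV_measurable.

Section gaussian_vector.
Context (R : realType) (dO : measure_display) (Omega : measurableType dO).
Variable (P : probability Omega R).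
Notation N := (@normal_prob R 0 1).

(** Allowing the full line as a factor merges independence and the marginal laws
    into one product formula over all coordinates. *)
Lemma standard_normal_vectorP d (X : Omega -> 'rV[R]_d) :
  standard_normal_vector P X <->
  forall A : 'I_d -> set R, (forall j, measurable (A j)) ->
    P [set w | forall j, A j (X w ord0 j)] = (\prod_j N (A j))%E.
Proof.
split=> [[indX margX] A mA|XA].
  rewrite -(_ : [set w | forall j, j \in [set: 'I_d]%SET -> A j (X w ord0 j)] =
                [set w | forall j, A j (X w ord0 j)]).
    rewrite indX//; apply: eq_big => [j|j _]; first by rewrite finset.in_setT.
    exact: margX.
  by apply/seteqP; split=> w /= H j => [|_]; apply: H; rewrite finset.in_setT.
have XJ (J : {set 'I_d}) (A : 'I_d -> set R) : (forall j, measurable (A j)) ->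
    P [set w | forall j, j \in J -> A j (X w ord0 j)] = (\prod_(j in J) N (A j))%E.
  move=> mA; pose B j := if j \in J then A j else setT.
  have mB j : measurable (B j) by rewrite /B; case: ifP.
  rewrite (_ : [set w | _] = [set w | forall j, B j (X w ord0 j)]).
    rewrite XA// [RHS]big_mkcond; apply: eq_bigr => j _; rewrite /B; case: ifP => //.
    by rewrite probability_setT.
  apply/seteqP; split=> w /= H j; rewrite /B.
    by case: ifPn => // jJ; exact: H.
  by move=> jJ; have := H j; rewrite /B jJ.
have Xj j (A : set R) : measurable A -> P [set w | A (X w ord0 j)] = N A.
  move=> mA; have := XJ [set j]%SET (fun=> A) (fun=> mA); rewrite big_set1 => <-.
  congr (P _); apply/seteqP; split=> w /= H => [i|]; first by rewrite inE => /eqP ->.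
  by apply: H; rewrite inE.
split; last exact: Xj.
by move=> J A mA; rewrite XJ//; apply: eq_bigr => j _; rewrite Xj.
Qed.

(** Independence is given for events on single coordinates; a rotation mixes two
    of them, so the pair (i, j) has to be handled as a planar variable that is
    independent of the remaining coordinates. *)
Lemma standard_normal_pair d (X : Omega -> 'rV[R]_d) (i j : 'I_d)
    (A : 'I_d -> set R) (S : set (R * R)) :
  measurable_fun setT X -> standard_normal_vector P X -> i != j ->
  (forall k, measurable (A k)) -> measurable S ->
  P [set w | S (X w ord0 i, X w ord0 j) /\
             forall k, k != i -> k != j -> A k (X w ord0 k)] =
  ((N \x N) S * \prod_(k | (k != i) && (k != j)) N (A k))%E.
Proof.
move=> mX /standard_normal_vectorP XN ij mA mS.
have mXk k : measurable_fun setT (fun w => X w ord0 k).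
  exact: (measurableT_comp (@measurable_coord R d k) mX).
pose rest := [set w | forall k, k != i -> k != j -> A k (X w ord0 k)].
have mrest : measurable rest.
  rewrite (_ : rest = \big[setI/setT]_(k | (k != i) && (k != j))
      ((fun w => X w ord0 k) @^-1` A k)).
    by apply: bigsetI_measurable => k _; rewrite -[X in measurable X]setTI; exact: mXk.
  rewrite -bigcap_seq_cond; apply/seteqP; split=> w /= H k => [/andP[_ /andP[ki kj]]|ki kj].
    exact: H.
  by apply: H => /=; rewrite mem_index_enum ki kj.
pose K := fine (\prod_(k | (k != i) && (k != j)) N (A k))%E.
have KE : K%:E = (\prod_(k | (k != i) && (k != j)) N (A k))%E.
  rewrite fineK//; apply: prode_fin_num => k _; exact: (fin_num_measure N _ (mA k)).
have K0 : 0 <= K by rewrite -lee_fin KE; apply: prode_ge0 => k _; exact: measure_ge0.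
have rect (B C : set R) : measurable B -> measurable C ->
    P [set w | (B (X w ord0 i) /\ C (X w ord0 j)) /\ rest w] = (N B * N C * K%:E)%E.
  move=> mB mC.
  pose A' k := if k == i then B else if k == j then C else A k.
  rewrite (_ : [set w | _] = [set w | forall k, A' k (X w ord0 k)]).
    rewrite XN; last by move=> k; rewrite /A'; case: eqP => // _; case: eqP.
    rewrite (bigD1 i)//= (bigD1 j)//=; last by rewrite eq_sym.
    rewrite KE muleA /A' eqxx (eq_sym j i) (negbTE ij) eqxx; congr (_ * _)%E.
    by apply: eq_bigr => k /andP[/negbTE -> /negbTE ->].
  apply/seteqP; split=> w /=.
    move=> [[Bw Cw] rw] k; rewrite /A'; case: eqP => [->//|/eqP ki].
    by case: eqP => [->//|/eqP kj]; exact: rw.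
  move=> H; split; first split.
  - by have := H i; rewrite /A' eqxx.
  - by have := H j; rewrite /A' eqxx eq_sym (negbTE ij).
  - by move=> k ki kj; have := H k; rewrite /A' (negbTE ki) (negbTE kj).
have mXij : measurable_fun setT (fun w => (X w ord0 i, X w ord0 j)).
  exact: measurable_fun_pair.
rewrite -KE; apply: (@weighted_product_law _ _ _ (measurableTypeR R) (measurableTypeR R) _ R P N N
  (fun w => (X w ord0 i, X w ord0 j)) rest K S) => //.
have := rect _ _ (@measurableT _ R) (@measurableT _ R).
have NT : N setT = 1%E by exact: probability_setT.
rewrite NT !mul1e => <-.
by congr (P _); apply/seteqP; split=> w /= => [|[]].
Qed.

End gaussian_vector.

Lemma measurable_dot (R : realType) d (a : 'rV[R]_d) :
  measurable_fun [set: 'rV[R]_d] (fun v => dot v a).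
Proof.
rewrite /dot; apply: measurable_sum => j.
by apply: measurable_funM => //; exact: measurable_coord.
Qed.

Section givens.
Context (R : realType) (d : nat).
Implicit Types (u v a : 'rV[R]_d) (i j k : 'I_d).

Lemma dotC u v : dot u v = dot v u.
Proof. by apply: eq_bigr => j _; rewrite mulrC. Qed.

Definition givens i j (c s : R) v : 'rV[R]_d :=
  \row_k (if k == i then c * v ord0 i + s * v ord0 j
          else if k == j then - s * v ord0 i + c * v ord0 j else v ord0 k).

Lemma dot_givens i j c s u v : i != j -> c ^+ 2 + s ^+ 2 = 1 ->
  dot (givens i j c s u) (givens i j c s v) = dot u v.
Proof.
move=> ij cs1; have ji : j != i by rewrite eq_sym.
rewrite /dot (bigD1 i)//= (bigD1 j)//= [RHS](bigD1 i)//= [in RHS](bigD1 j)//=.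
rewrite !mxE !eqxx (negbTE ji) !addrA; congr (_ + _); last first.
  by apply: eq_bigr => k /andP[/negbTE ki /negbTE kj]; rewrite !mxE ki kj.
transitivity ((c ^+ 2 + s ^+ 2) * (u ord0 i * v ord0 i + u ord0 j * v ord0 j)).
  by ring.
by rewrite cs1 mul1r.
Qed.

Context (dO : measure_display) (Omega : measurableType dO) (P : probability Omega R).
Notation N := (@normal_prob R 0 1).

Lemma measurable_givens i j c s : measurable_fun setT (givens i j c s).
Proof.
apply: measurable_rVP => k; rewrite /givens.
have lin (x y : R) : measurable_fun setT (fun v : 'rV[R]_d => x * v ord0 i + y * v ord0 j).
  by apply: measurable_funD; apply: measurable_funM => //; exact: measurable_coord.
under eq_fun do rewrite mxE.
case: (k == i); first exact: lin.
by case: (k == j); [exact: lin|exact: measurable_coord].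
Qed.

Lemma standard_normal_givens i j c s (X : Omega -> 'rV[R]_d) :
  i != j -> s != 0 -> c ^+ 2 + s ^+ 2 = 1 ->
  measurable_fun setT X -> standard_normal_vector P X ->
  standard_normal_vector P (givens i j c s \o X).
Proof.
move=> ij s0 cs1 mX XN; have ji : j != i by rewrite eq_sym.
apply/standard_normal_vectorP => A mA.
pose S : set (R * R) := [set z | A i (c * z.1 + s * z.2) /\ A j (- s * z.1 + c * z.2)].
have mlin (a b : R) : measurable_fun setT (fun z : R * R => a * z.1 + b * z.2).
  by apply: measurable_funD; exact: measurable_funM.
have mS : measurable S.
  rewrite (_ : S = (fun z : R * R => c * z.1 + s * z.2) @^-1` (A i) `&`
     (fun z : R * R => - s * z.1 + c * z.2) @^-1` (A j))//.
  by apply: measurableI; rewrite -[X in measurable X]setTI; exact: mlin.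
transitivity (P [set w | S (X w ord0 i, X w ord0 j) /\
             forall k, k != i -> k != j -> A k (X w ord0 k)]).
  congr (P _); apply/seteqP; split=> w /=.
    move=> H; split; first split.
    - by have := H i; rewrite mxE eqxx.
    - by have := H j; rewrite mxE eqxx (negbTE ji).
    - by move=> k /negbTE ki /negbTE kj; have := H k; rewrite mxE ki kj.
  move=> [[Hi Hj] H] k; rewrite mxE; case: eqP => [->//|/eqP ki].
  by case: eqP => [->//|/eqP kj]; exact: H.
rewrite standard_normal_pair// [RHS](bigD1 i)//= [in RHS](bigD1 j)//= [RHS]muleA; congr (_ * _)%E.
exact: normal_prod_rotation_set.
Qed.

End givens.

Section reduction.
Context (R : realType) (d : nat).
Context (dO : measure_display) (Omega : measurableType dO) (P : probability Omega R).
Implicit Types (u v a : 'rV[R]_d) (i j k : 'I_d).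

(** The two properties that the reduction to two coordinates needs from a change
    of coordinates; both survive composition. *)
Definition gaussian_isometry (T : 'rV[R]_d -> 'rV[R]_d) :=
  (forall u v, dot (T u) (T v) = dot u v) /\
  forall X : Omega -> 'rV[R]_d, measurable_fun setT X -> standard_normal_vector P X ->
    measurable_fun setT (T \o X) /\ standard_normal_vector P (T \o X).

Lemma gaussian_isometry_comp T1 T2 : gaussian_isometry T1 -> gaussian_isometry T2 ->
  gaussian_isometry (T2 \o T1).
Proof.
move=> [d1 n1] [d2 n2]; split=> [u v|X mX XN]; first by rewrite /= d2.
by have [mTX TXN] := n1 X mX XN; exact: (n2 (T1 \o X)).
Qed.

(** Givens rotations in the planes (i, k), for k in l, move the mass of a from the
    coordinates in l into coordinate i.  The last two clauses let a second
    round, with another pivot, leave the result of the first one intact. *)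
Lemma zero_out i (l : seq 'I_d) a : i \notin l ->
  exists T, [/\ gaussian_isometry T,
    forall k, k \in l -> T a ord0 k = 0,
    forall v k, k != i -> k \notin l -> T v ord0 k = v ord0 k &
    forall v, v ord0 i = 0 -> (forall k, k \in l -> v ord0 k = 0) -> T v = v].
Proof.
elim: l => [|k l IH]; first by exists id.
rewrite inE negb_or => /andP[ik il]; have [T [Tiso Tl Tv T0]] := IH il.
have vl v : v ord0 i = 0 -> (forall h, h \in k :: l -> v ord0 h = 0) -> T v = v.
  by move=> vi vkl; apply: T0 => // h hl; apply: vkl; rewrite inE hl orbT.
have [ak0|ak0] := eqVneq (T a ord0 k) 0.
  exists T; split=> //.
    by move=> h; rewrite inE => /orP[/eqP ->//|]; exact: Tl.
  by move=> v h hi; rewrite inE negb_or => /andP[_]; exact: Tv.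
pose r := Num.sqrt (T a ord0 i ^+ 2 + T a ord0 k ^+ 2).
have r2 : r ^+ 2 = T a ord0 i ^+ 2 + T a ord0 k ^+ 2.
  by rewrite sqr_sqrtr// addr_ge0// sqr_ge0.
have r0 : r != 0.
  apply: contra_eqN r2 => /eqP ->; rewrite expr0n/= eq_sym.
  by rewrite paddr_eq0 ?sqr_ge0// !expf_eq0/= negb_and ak0 orbT.
(* the rotation that sends (T a)_i, (T a)_k to r, 0 *)
pose c := T a ord0 i / r; pose s := T a ord0 k / r.
have s0 : s != 0 by rewrite mulf_neq0// invr_eq0.
have cs1 : c ^+ 2 + s ^+ 2 = 1.
  by rewrite /c /s !expr_div_n -mulrDl -r2 divff// expf_neq0.
have Giso : gaussian_isometry (givens i k c s).
  split=> [u v|X mX XN]; first exact: dot_givens.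
  split; last exact: standard_normal_givens.
  exact: (measurableT_comp (measurable_givens i k c s)).
exists (givens i k c s \o T); split.
- exact: gaussian_isometry_comp.
- have Gk : givens i k c s (T a) ord0 k = 0.
    by rewrite mxE eq_sym (negbTE ik) eqxx /c /s; field.
  move=> h hkl /=; have [->//|hk] := eqVneq h k; rewrite /= mxE (negbTE hk).
  case: eqP => [hi|_]; last by apply: Tl; move: hkl; rewrite inE (negbTE hk).
  by move: hkl; rewrite inE (negbTE hk)/= hi (negbTE il).
- move=> v h hi; rewrite inE negb_or => /andP[hk hl] /=.
  by rewrite mxE (negbTE hi) (negbTE hk) Tv.
- move=> v vi vkl /=; rewrite vl//; apply/rowP => h; rewrite mxE.
  have vk : v ord0 k = 0 by apply: vkl; rewrite inE eqxx.
  by rewrite vi vk !mulr0 addr0; case: eqP => [->//|_]; case: eqP => [->|].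
Qed.

End reduction.

(** * Joint law of two projections *)

Section projections.
Context (R : realType) (dO : measure_display) (Omega : measurableType dO)
  (P : probability Omega R).
Notation mu := (@lebesgue_measure R).
Notation N := (@normal_prob R 0 1).

Definition std_normal (u : Omega -> R) :=
  measurable_fun setT u /\ forall A, measurable A -> P [set w | A (u w)] = N A.

Lemma normal_prob_opp (A : set R) : measurable A -> N (-%R @^-1` A) = N A.
Proof.
move=> mA; have mN : measurable_fun [set: measurableTypeR R] (-%R : measurableTypeR R -> measurableTypeR R).
  exact: oppr_measurable.
have mp : measurable_fun [set: measurableTypeR R] (EFin \o @normal_pdf R 0 1).
  by apply/measurable_EFinP; exact: measurable_normal_pdf.
have p0 x : (0 <= (EFin \o @normal_pdf R 0 1) x)%E by rewrite lee_fin normal_pdf_ge0.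
have /= := @ge0_integral_pushforward _ _ (measurableTypeR R) (measurableTypeR R) R
  _ mN mu A (EFin \o @normal_pdf R 0 1) mA (measurable_funS measurableT (@subsetT _ _) mp) (fun y _ => p0 y).
rewrite /normal_prob => E; apply: etrans; last first.
  apply: etrans; first apply: esym E.
  by apply: eq_measure_integral => //= B mB _; exact: lebesgue_measureN.
apply: eq_integral => x _ /=; congr _%:E; rewrite !normal_pdfE ?oner_eq0//.
by rewrite /normal_fun !subr0 sqrrN.
Qed.

Lemma std_normal_opp u : std_normal u -> std_normal (fun w => - u w).
Proof.
move=> [mu_ uN]; split; first exact: measurableT_comp.
move=> A mA; rewrite -normal_prob_opp//; apply: (uN (-%R @^-1` A)).
by rewrite -[X in measurable X]setTI; exact: oppr_measurable.
Qed.

Lemma std_normal_sign (e : R) u : e ^+ 2 = 1 -> std_normal u -> std_normal (fun w => e * u w).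
Proof.
move=> /eqP; rewrite sqrf_eq1 => /orP[] /eqP-> uN.
  by rewrite (_ : (fun w => _) = u)//; apply/funext => w; rewrite mul1r.
rewrite (_ : (fun w => _) = (fun w => - u w)); first exact: std_normal_opp.
by apply/funext => w; rewrite mulN1r.
Qed.

Lemma std_normal_coord d (X : Omega -> 'rV[R]_d) j :
  measurable_fun setT X -> standard_normal_vector P X -> std_normal (fun w => X w ord0 j).
Proof.
move=> mX [_ XN]; split; last by move=> A mA; exact: XN.
exact: (measurableT_comp (@measurable_coord R d j) mX).
Qed.

Lemma independent_coords d (X : Omega -> 'rV[R]_d) i j (f g : R -> R) :
  measurable_fun setT X -> standard_normal_vector P X -> i != j ->
  measurable_fun setT f -> measurable_fun setT g ->
  (forall x, 0 <= f x) -> (forall x, 0 <= g x) ->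
  (\int[P]_w (f (X w ord0 i))%:E < +oo)%E -> (\int[P]_w (g (X w ord0 j))%:E < +oo)%E ->
  (\int[P]_w (f (X w ord0 i) * g (X w ord0 j))%:E =
   \int[P]_w (f (X w ord0 i))%:E * \int[P]_w (g (X w ord0 j))%:E)%E.
Proof.
move=> mX [indX _] ij mf mg f0 g0 foo goo; have ji : j != i by rewrite eq_sym.
pose h k : R -> R := if k == i then f else if k == j then g else cst 1.
have mXk k : measurable_fun setT (fun w => X w ord0 k).
  exact: (measurableT_comp (@measurable_coord R d k) mX).
have h1 : (\int[P]_w 1%:E = 1)%E.
  by rewrite integral_cst// mul1e; exact: probability_setT.
have hk k : k != i -> k != j -> h k = cst 1.
  by move=> /negbTE ki /negbTE kj; rewrite /h ki kj.
have hi : h i = f by rewrite /h eqxx.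
have hj : h j = g by rewrite /h eqxx (negbTE ji).
have := @independent_integral_prod _ _ Omega R R P _ (fun k w => X w ord0 k) mXk indX h.
have -> : (\prod_k \int[P]_w (h k (X w ord0 k))%:E =
   \int[P]_w (f (X w ord0 i))%:E * \int[P]_w (g (X w ord0 j))%:E)%E.
  rewrite (bigD1 i)//= (bigD1 j)//= big1 ?mule1 ?hi ?hj// => k /andP[ki kj].
  by rewrite hk.
move=> <-.
- apply: eq_integral => w _; congr _%:E.
  rewrite (bigD1 i)//= (bigD1 j)//= big1 ?mulr1 ?hi ?hj// => k /andP[ki kj].
  by rewrite hk.
- by move=> k; rewrite /h; case: eqP => // _; case: eqP.
- by move=> k x; rewrite /h; case: eqP => // _; case: eqP => //= _; rewrite ler01.
- move=> k; rewrite /h; case: eqP => [->//|_]; case: eqP => [->//|_].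
  by rewrite h1 ltry.
Qed.

Lemma dot_single d (u v : 'rV[R]_d) i : (forall k, k != i -> v ord0 k = 0) ->
  dot u v = u ord0 i * v ord0 i.
Proof.
by move=> v0; rewrite /dot (bigD1 i)//= big1 ?addr0// => k ki; rewrite v0 ?mulr0.
Qed.

(** After two rounds of Givens rotations a lies on the first axis and b in the
    plane of the first two, so z is, up to sign, the second coordinate of the
    rotated vector.  In dimension 1 there is no second coordinate; then the
    factor of z is 0, and z = 0 satisfies the same product rule. *)
Lemma gaussian_projections d (X : Omega -> 'rV[R]_d) (a b : 'rV[R]_d) :
  measurable_fun setT X -> standard_normal_vector P X ->
  dot a a = 1 -> dot b b = 1 ->
  std_normal (fun w => dot (X w) a) /\
  exists z : Omega -> R, [/\
    std_normal z \/ z = cst 0,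
    forall w, dot (X w) b = dot a b * dot (X w) a + Num.sqrt (1 - dot a b ^+ 2) * z w &
    forall f g : R -> R, measurable_fun setT f -> measurable_fun setT g ->
      (forall x, 0 <= f x) -> (forall x, 0 <= g x) ->
      (\int[P]_w (f (dot (X w) a))%:E < +oo)%E -> (\int[P]_w (g (z w))%:E < +oo)%E ->
      (\int[P]_w (f (dot (X w) a) * g (z w))%:E =
       \int[P]_w (f (dot (X w) a))%:E * \int[P]_w (g (z w))%:E)%E].
Proof.
move=> mX XN a1 b1.
case: d => [|d] in X a b mX XN a1 b1 *.
  by move: a1; rewrite /dot big_ord0 => /esym/eqP; rewrite oner_eq0.
have [T1 [T1iso T1a _ _]] := @zero_out R d.+1 _ _ P ord0 [seq k <- enum 'I_d.+1 | k != ord0] a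
  (ltac:(by rewrite mem_filter eqxx)).
have {}T1a k : k != ord0 -> T1 a ord0 k = 0.
  by move=> k0; apply: T1a; rewrite mem_filter k0 mem_enum.
have [mT1X T1XN] := T1iso.2 X mX XN.
have dotTa w : dot (X w) a = T1 (X w) ord0 ord0 * T1 a ord0 ord0.
  by rewrite -T1iso.1; exact: dot_single.
have al1 : T1 a ord0 ord0 ^+ 2 = 1 by rewrite expr2 -dot_single// T1iso.1.
have uN : std_normal (fun w => dot (X w) a).
  rewrite (_ : (fun w => _) = (fun w => T1 a ord0 ord0 * T1 (X w) ord0 ord0)).
    by apply: std_normal_sign => //; exact: std_normal_coord.
  by apply/funext => w; rewrite dotTa mulrC.
split=> //; have rhoE : dot a b = T1 a ord0 ord0 * T1 b ord0 ord0.
  by rewrite dotC -T1iso.1 (dot_single _ T1a) mulrC.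
set al := T1 a ord0 ord0 in dotTa al1 rhoE *.
case: d => [|d] in X a b mX XN a1 b1 T1 T1iso al T1a mT1X T1XN dotTa al1 uN rhoE *.
  exists (cst 0); split; first by right.
    move=> w; rewrite -T1iso.1 dotTa rhoE (@dot_single _ _ _ ord0); last first.
      by move=> k; rewrite ord1.
    rewrite mulr0 addr0; transitivity (al ^+ 2 * (T1 (X w) ord0 ord0 * T1 b ord0 ord0)).
      by rewrite al1 mul1r.
    ring.
  move=> f g mf mg f0 g0 foo goo.
  transitivity (\int[P]_w ((f (dot (X w) a))%:E * (g 0)%:E))%E; first exact: eq_integral.
  rewrite ge0_integralZr//=.
  - congr (_ * _)%E; rewrite -[LHS]mule1 -(_ : P setT = 1%E); last exact: probability_setT.
    by rewrite -integral_cst.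
  - by apply/measurable_EFinP; apply: measurableT_comp => //; exact: uN.1.
  - by move=> w _; rewrite lee_fin.
  - by rewrite lee_fin.
pose i1 : 'I_d.+2 := lift ord0 ord0.
have [T2 [T2iso T2b T2v T20]] := @zero_out R d.+2 _ _ P i1
  [seq k <- enum 'I_d.+2 | (k != ord0) && (k != i1)] (T1 b)
  (ltac:(by rewrite mem_filter eqxx andbF)).
have {}T2b k : k != ord0 -> k != i1 -> T2 (T1 b) ord0 k = 0.
  by move=> k0 k1; apply: T2b; rewrite mem_filter k0 k1 mem_enum.
have T2a : T2 (T1 a) = T1 a.
  apply: T20; first exact: T1a.
  by move=> k; rewrite mem_filter => /andP[/andP[k0 _] _]; exact: T1a.
have [mT2X T2XN] := T2iso.2 _ mT1X T1XN.
pose x w := T2 (T1 (X w)).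
pose be := T2 (T1 b) ord0 ord0; pose ga := T2 (T1 b) ord0 i1.
have dot2 v : dot v (T2 (T1 b)) = v ord0 ord0 * be + v ord0 i1 * ga.
  rewrite /dot (bigD1 ord0)//= (bigD1 i1)//= big1 ?addr0// => k /andP[k0 k1].
  by rewrite T2b// mulr0.
have xa w : dot (X w) a = x w ord0 ord0 * al.
  by rewrite -T1iso.1 -T2iso.1 T2a; exact: dot_single.
have xb w : dot (X w) b = x w ord0 ord0 * be + x w ord0 i1 * ga.
  by rewrite -T1iso.1 -T2iso.1 dot2.
have rho2 : dot a b = al * be.
  by rewrite -T1iso.1 -T2iso.1 T2a dot2 (T1a i1)// mul0r addr0.
have bega : be ^+ 2 + ga ^+ 2 = 1.
  by rewrite !expr2 -dot2 T2iso.1 T1iso.1.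
(* The sign turns the coefficient ga into the nonnegative square root. *)
pose e : R := if ga < 0 then -1 else 1.
have e2 : e ^+ 2 = 1 by rewrite /e; case: ifP => _; rewrite ?sqrrN expr1n.
have ega : Num.sqrt (1 - dot a b ^+ 2) * e = ga.
  rewrite rho2 exprMn al1 mul1r -bega addrAC subrr add0r sqrtr_sqr /e.
  by case: ltrP => ga0; [rewrite ltr0_norm// mulrN1 opprK|rewrite ger0_norm// mulr1].
exists (fun w => e * x w ord0 i1); split.
- by left; apply: std_normal_sign => //; exact: (std_normal_coord _ mT2X).
- move=> w; rewrite mulrA ega xa xb rho2.
  transitivity (al ^+ 2 * be * x w ord0 ord0 + ga * x w ord0 i1); last by ring.
  by rewrite al1; ring.
- move=> f g mf mg f0 g0.
  have -> : (\int[P]_w (f (dot (X w) a))%:E = \int[P]_w (f (al * x w ord0 ord0))%:E)%E.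
    by apply: eq_integral => w _; rewrite xa mulrC.
  have -> : (\int[P]_w (f (dot (X w) a) * g (e * x w ord0 i1))%:E =
      \int[P]_w (f (al * x w ord0 ord0) * g (e * x w ord0 i1))%:E)%E.
    by apply: eq_integral => w _; rewrite xa [X in f X]mulrC.
  apply: (@independent_coords _ _ ord0 i1 (fun y => f (al * y)) (fun y => g (e * y)) mT2X T2XN) => //.
  + by apply: measurableT_comp => //; exact: measurable_funM.
  + by apply: measurableT_comp => //; exact: measurable_funM.
Qed.

End projections.

(** * Means of real random variables and Gaussian moments *)

Section mean.
Context (R : realType) (dO : measure_display) (Omega : measurableType dO)
  (P : probability Omega R).
Implicit Types (f g : Omega -> R) (e k : R).

(** Integrability together with the value of the integral, so that linear
    combinations are handled without side conditions on integrability. *)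
Definition has_mean f e :=
  P.-integrable setT (EFin \o f) /\ (\int[P]_w (f w)%:E = e%:E)%E.

Lemma has_mean_ge0 f : measurable_fun setT f -> (forall w, 0 <= f w) ->
  (\int[P]_w (f w)%:E < +oo)%E -> has_mean f (fine (\int[P]_w (f w)%:E)%E).
Proof.
move=> mf f0 foo; split.
  apply/integrableP; split; first exact/measurable_EFinP.
  by under eq_integral do rewrite /= ger0_norm//.
by rewrite fineK// ge0_fin_numE// integral_ge0// => w _; rewrite lee_fin.
Qed.

Lemma has_mean_dom f g e : measurable_fun setT f -> has_mean g e ->
  (forall w, `|f w| <= g w) -> exists e', has_mean f e'.
Proof.
move=> mf [ig _] fg.
have int_f : P.-integrable setT (EFin \o f).
  apply: (le_integrable _ _ _ ig) => //; first exact/measurable_EFinP.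
  by move=> w _ /=; rewrite lee_fin (le_trans (fg w))// ler_norm.
exists (fine (\int[P]_w (f w)%:E)%E); split=> //.
by rewrite fineK//; exact: integrable_fin_num int_f.
Qed.

Lemma has_meanD f g e k : has_mean f e -> has_mean g k ->
  has_mean (fun w => f w + g w) (e + k).
Proof.
move=> [int_f fe] [int_g gk]; split; first exact: (integrableD _ int_f int_g).
by rewrite integralD_EFin// fe gk.
Qed.

Lemma has_meanZ k f e : has_mean f e -> has_mean (fun w => k * f w) (k * e).
Proof.
move=> [int_f fe]; split; first exact: (integrableZl _ _ int_f).
under eq_integral do rewrite EFinM.
by rewrite integralZl// fe.
Qed.

Lemma has_mean_cst k : has_mean (fun=> k) k.
Proof.
split; first exact: finite_measure_integrable_cst.
rewrite integral_cst// -[RHS]mule1; congr (_ * _)%E; exact: probability_setT.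
Qed.

Lemma has_mean_le f g e k : has_mean f e -> has_mean g k -> (forall w, f w <= g w) -> e <= k.
Proof.
move=> [int_f fe] [int_g gk] fg; rewrite -lee_fin -fe -gk.
by apply: le_integral => // w _; rewrite lee_fin.
Qed.

Lemma integral_le_mean f g e : measurable_fun setT f -> (forall w, 0 <= f w <= g w) ->
  has_mean g e -> (\int[P]_w (f w)%:E <= e%:E)%E.
Proof.
move=> mf fg ge; have [|k fk] := has_mean_dom mf ge.
  by move=> w; have /andP[f0 ?] := fg w; rewrite ger0_norm.
rewrite fk.2 lee_fin; apply: has_mean_le fk ge _ => w.
by have /andP[] := fg w.
Qed.

End mean.

Lemma expR_half_le2 (R : realType) : expR (2^-1 : R) <= 2.
Proof.
have := expR_ge1Dx (- 2^-1 : R); rewrite expRN => h.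
have e0 := expR_gt0 (2^-1 : R).
have : (1 + - 2^-1) * expR 2^-1 <= (expR 2^-1)^-1 * expR 2^-1 :> R by rewrite ler_pM2r.
rewrite mulVf ?gt_eqF// => H; lra.
Qed.

Section gaussian_moments.
Context (R : realType) (dO : measure_display) (Omega : measurableType dO)
  (P : probability Omega R).
Notation mu := (@lebesgue_measure R).
Notation p := (@normal_pdf R 0 1).
Implicit Types (u : Omega -> R).

Let p0 x : 0 <= p x := normal_pdf_ge0 0 1 x.
Let mp : measurable_fun [set: R] p := measurable_normal_pdf 0 1.
Let intp : (\int[mu]_x (p x)%:E = 1)%E := integral_normal_pdf 0 1.

Lemma std_normal_integral u (f : R -> R) : std_normal P u ->
  measurable_fun setT f -> (forall x, 0 <= f x) ->
  (\int[P]_w (f (u w))%:E = \int[mu]_x (p x * f x)%:E)%E.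
Proof.
move=> [mu_ uN] mf f0; apply: (@normal_transfer R _ _ P u (EFin \o f)) => //.
- exact/measurable_EFinP.
Qed.

(** Completing the square turns the integrand into a translate of the density. *)
Lemma std_normal_expR u t : std_normal P u ->
  has_mean P (fun w => expR (t * u w)) (expR (t ^+ 2 / 2)).
Proof.
move=> uN; have mf : measurable_fun setT (fun x : R => expR (t * x)).
  by apply: measurableT_comp => //; exact: measurable_funM.
suff E : (\int[P]_w (expR (t * u w))%:E = (expR (t ^+ 2 / 2))%:E)%E.
  have := @has_mean_ge0 _ _ _ P (fun w => expR (t * u w)) (measurableT_comp mf uN.1).
  by rewrite E; apply; rewrite ?ltry// => w; exact: expR_ge0.
rewrite (@std_normal_integral _ (fun x => expR (t * x)))//.
rewrite -(@ge0_integral_translation _ t)//; last 2 first.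
- exact: measurable_funM.
- by move=> x; rewrite mulr_ge0// expR_ge0.
under eq_integral => x _.
  have -> : p (x + t) * expR (t * (x + t)) = expR (t ^+ 2 / 2) * p x.
    rewrite !normal_pdfE ?oner_eq0// /normal_fun !subr0 expr1n.
    rewrite -mulrA [RHS]mulrCA -!expRD; congr (_ * expR _).
    by field.
  rewrite EFinM.
  over.
rewrite ge0_integralZl//= ?intp ?mule1//.
- exact/measurable_EFinP.
- by move=> x _; rewrite lee_fin.
Qed.

Lemma std_normal_expR_abs u t : std_normal P u -> 0 <= t ->
  exists2 e, has_mean P (fun w => expR (t * `|u w|)) e & e <= 2 * expR (t ^+ 2 / 2).
Proof.
move=> uN t0.
have mf : measurable_fun setT (fun w => expR (t * `|u w|)).
  apply: measurableT_comp => //; apply: measurable_funM => //.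
  by apply: measurableT_comp => //; exact: uN.1.
have H := has_meanD (std_normal_expR t uN) (std_normal_expR (- t) uN).
have fg w : expR (t * `|u w|) <= expR (t * u w) + expR (- t * u w).
  have [u0|u0] := lerP 0 (u w); first by rewrite ger0_norm// lerDl expR_ge0.
  by rewrite ltr0_norm// mulrN -mulNr lerDr expR_ge0.
have [|e fe] := has_mean_dom mf H.
  by move=> w; rewrite ger0_norm ?expR_ge0.
exists e => //; apply: le_trans (has_mean_le fe H fg) _.
by rewrite sqrrN mulr_natl mulr2n.
Qed.

Lemma normal_peak1_le1 : @normal_peak R 1 <= 1.
Proof.
rewrite /normal_peak invf_le1 ?sqrtr_gt0; last first.
  by rewrite expr1n mul1r pmulrn_rgt0// pi_gt0.
rewrite -[leLHS]sqrtr1 ler_wsqrtr// expr1n mul1r.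
have := @pi_ge2 R; lra.
Qed.

(** The normal density is at most 1 and exp(- b |x|) has Lebesgue integral 2 / b;
    the latter is read off from the exponential distribution on each half-line. *)
Lemma std_normal_expR_Nabs u b : std_normal P u -> 0 < b ->
  exists2 e, has_mean P (fun w => expR (- b * `|u w|)) e & e <= 2 / b.
Proof.
move=> uN b0; pose q := @exponential_pdf R b.
have q0 x : 0 <= q x by apply: exponential_pdf_ge0; exact: ltW.
have mq : measurable_fun setT q := measurable_exponential_pdf b.
have half u' : std_normal P u' ->
    exists2 e, has_mean P (fun w => q (u' w)) e & e <= 1.
  move=> uN'.
  have E : (\int[P]_w (q (u' w))%:E <= 1%:E)%E.
    rewrite std_normal_integral// -(integral_exponential_pdf b0).
    apply: ge0_le_integral => //.
    - by move=> x _; rewrite lee_fin mulr_ge0.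
    - by apply/measurable_EFinP; exact: measurable_funM.
    - exact/measurable_EFinP.
    - move=> x _; rewrite lee_fin ler_piMl//.
      apply: le_trans (normal_pdf_ub _ _ _) normal_peak1_le1.
      exact: oner_neq0.
  have mm := @has_mean_ge0 _ _ _ P (fun w => q (u' w)) (measurableT_comp mq uN'.1)
    (fun w => q0 _) (le_lt_trans E (ltry _)).
  by exists (fine (\int[P]_w (q (u' w))%:E)%E) => //; rewrite -lee_fin -mm.2.
have [e1 h1 e1l] := half _ uN.
have [e2 h2 e2l] := half _ (std_normal_opp uN).
have H := has_meanZ b^-1 (has_meanD h1 h2).
have mf : measurable_fun setT (fun w => expR (- b * `|u w|)).
  apply: measurableT_comp => //; apply: measurable_funM => //.
  by apply: measurableT_comp => //; exact: uN.1.
have fg w : expR (- b * `|u w|) <= b^-1 * (q (u w) + q (- u w)).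
  rewrite ler_pdivlMl//.
  have [u0|u0] := lerP 0 (u w).
    by rewrite ger0_norm// {1}/q (exponential_pdfE _ u0) lerDl.
  rewrite ltr0_norm//; apply: (@le_trans _ _ (q (- u w))); last by rewrite lerDr.
  by rewrite /q exponential_pdfE// oppr_ge0 ltW.
have [|e fe] := has_mean_dom mf H.
  by move=> w; rewrite ger0_norm ?expR_ge0.
exists e => //; apply: le_trans (has_mean_le fe H fg) _.
rewrite mulrC ler_pM2r ?invr_gt0//; lra.
Qed.

End gaussian_moments.

(** * The sigmoid and pointwise bounds *)

Section sigmoid_facts.
Context {R : realType}.
Implicit Types x y : R.

Lemma sigmoid_gt0 x : 0 < sigmoid x.
Proof. by rewrite /sigmoid divr_gt0// addr_gt0// expR_gt0. Qed.

Lemma sigmoidN x : sigmoid (- x) = 1 - sigmoid x.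
Proof.
rewrite /sigmoid opprK expRN; have := expR_gt0 x; move: (expR x) => e e0.
by field; rewrite !gt_eqF// ?addr_gt0// ?invr_gt0.
Qed.

Lemma sigmoid_le1 x : sigmoid x <= 1.
Proof. by rewrite -subr_ge0 -sigmoidN ltW// sigmoid_gt0. Qed.

Lemma sigmoid_le_expR x : sigmoid x <= expR x.
Proof.
rewrite /sigmoid ler_pdivrMr; last by rewrite addr_gt0// expR_gt0.
by rewrite mulrDr mulr1 -expRD subrr expR0 lerDr ltW// expR_gt0.
Qed.

Lemma sigmoid_homo x y : x <= y -> sigmoid x <= sigmoid y.
Proof.
move=> xy; rewrite /sigmoid ler_pM2l// lef_pV2 ?posrE ?addr_gt0 ?expR_gt0//.
by rewrite lerD2l ler_expR lerN2.
Qed.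

Lemma measurable_sigmoid : measurable_fun [set: R] (@sigmoid R).
Proof.
by apply: nondecreasing_measurable => // x y; exact: sigmoid_homo.
Qed.

(** sigmoid_bias (beta * u) is the conditional mean of the label. *)
Definition sigmoid_bias x := sigmoid x - sigmoid (- x).

Lemma sigmoid_biasN x : sigmoid_bias (- x) = - sigmoid_bias x.
Proof. by rewrite /sigmoid_bias opprK opprB. Qed.

Lemma sigmoid_bias_homo x y : x <= y -> sigmoid_bias x <= sigmoid_bias y.
Proof. by move=> xy; apply: lerB; apply: sigmoid_homo; rewrite ?lerN2. Qed.

Lemma sigmoid_bias_ge0 x : 0 <= x -> 0 <= sigmoid_bias x.
Proof. by move=> x0; rewrite subr_ge0; apply: sigmoid_homo; lra. Qed.

Lemma sigmoid_bias_le1 x : `|sigmoid_bias x| <= 1.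
Proof.
rewrite ler_norml /sigmoid_bias sigmoidN; have := sigmoid_gt0 x; have := sigmoid_le1 x.
by move=> ? ?; apply/andP; split; lra.
Qed.

Lemma sigmoid_bias1_gt0 : 0 < sigmoid_bias 1.
Proof.
rewrite /sigmoid_bias subr_gt0 /sigmoid ltr_pM2l// ltf_pV2 ?posrE ?addr_gt0 ?expR_gt0//.
by rewrite ltrD2l ltr_expR; lra.
Qed.

Lemma measurable_sigmoid_bias : measurable_fun [set: R] sigmoid_bias.
Proof.
by apply: nondecreasing_measurable => // x y; exact: sigmoid_bias_homo.
Qed.

End sigmoid_facts.

Section pointwise.
Context {R : realType}.
Implicit Types x u v z : R.

Lemma expRN_le_ge0 x : 0 <= x -> expR (- x) <= 1 - x + x ^+ 2.
Proof.
move=> x0; have e0 := expR_gt0 x; have := expR_ge1Dx x => e1.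
rewrite expRN -[leLHS]mul1r ler_pdivrMr//.
apply: (@le_trans _ _ ((1 - x + x ^+ 2) * (1 + x))); last by rewrite ler_pM2l//; nra.
rewrite (_ : _ * _ = 1 + x ^+ 3); last by ring.
by rewrite lerDl exprn_ge0.
Qed.

Lemma expRN_le_le0 x : x <= 0 -> expR (- x) <= 1 - x + x ^+ 2 * expR (- x).
Proof.
move=> x0; have e0 := expR_gt0 (- x); have := expR_ge1Dx x => e1.
have : (1 + x) * expR (- x) <= expR x * expR (- x) by rewrite ler_pM2r.
rewrite -expRD subrr expR0 => H.
rewrite -subr_ge0; have -> : 1 - x + x ^+ 2 * expR (- x) - expR (- x) =
  (1 - x) * (1 - (1 + x) * expR (- x)) by ring.
by apply: mulr_ge0; lra.
Qed.

Lemma sqr_le_expR x : 0 <= x -> x ^+ 2 <= 4 * expR x.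
Proof.
move=> x0; have e := expR_ge1Dx (x / 2).
have -> : expR x = expR (x / 2) ^+ 2 by rewrite -expRM_natl; congr expR; field.
by nra.
Qed.

(** The two ways in which an excess loss can be nonzero: a label that contradicts
    the sign of u, and a sign change between u and v. *)
Definition second_order (b u v : R) :=
  (v - u) ^+ 2 * expR (- b * `|u|) + (if u * v <= 0 then v ^+ 2 else 0).

Lemma second_orderN b u v : second_order b (- u) (- v) = second_order b u v.
Proof.
rewrite /second_order mulrNN normrN (_ : - v - - u = - (v - u)) ?sqrrN//.
by ring.
Qed.

Lemma relu_lipschitz u v : (Num.max 0 v - Num.max 0 u) ^+ 2 <= (v - u) ^+ 2.
Proof.
case: (lerP 0 v) => v0; case: (lerP 0 u) => u0 //; rewrite ?subr0 ?sub0r ?subrr.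
- have : 0 <= v * - u by rewrite mulr_ge0// oppr_ge0 ltW.
  by nra.
- have : 0 <= - v * u by rewrite mulr_ge0// oppr_ge0 ltW.
  by nra.
- by rewrite expr0n/= sqr_ge0.
Qed.

(** For u < 0 the excess is nonnegative, and a quadratic bound on the exponential
    suffices; there the excess is nonzero only if v > 0.  For u >= 0 the excess may
    be as low as - u, but the factor exp(l u) is paid for by the sigmoid weight,
    which is at most exp(- beta u), because l <= beta / 2. *)
Lemma excess_expR_le (beta l u v : R) : 0 <= l -> l <= beta / 2 ->
  sigmoid (- (beta * u)) * expR (- (l * (Num.max 0 v - Num.max 0 u))) <=
  sigmoid (- (beta * u)) * (1 - l * (Num.max 0 v - Num.max 0 u)) +
    l ^+ 2 * second_order (beta / 2) u v.
Proof.
move=> l0 lb; set s := sigmoid _; set D := Num.max 0 v - Num.max 0 u.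
have s0 : 0 < s := sigmoid_gt0 _.
have s1 : s <= 1 := sigmoid_le1 _.
have DD : D ^+ 2 <= (v - u) ^+ 2 := relu_lipschitz u v.
have Q0 : 0 <= (v - u) ^+ 2 * expR (- (beta / 2) * `|u|).
  by rewrite mulr_ge0 ?sqr_ge0 ?expR_ge0.
have [u0|u0] := lerP 0 u; last first.
  have D0 : D = Num.max 0 v by rewrite /D (max_l (ltW u0)) subr0.
  have D_ge0 : 0 <= D by rewrite D0 le_max lexx.
  have e1 := expRN_le_ge0 (mulr_ge0 l0 D_ge0).
  have D2 : D ^+ 2 <= (if u * v <= 0 then v ^+ 2 else 0).
    rewrite D0; case: (lerP 0 v) => v0; first by rewrite ifT// nmulr_rle0.
    by rewrite expr0n/=; case: ifP => // _; exact: sqr_ge0.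
  have : s * expR (- (l * D)) <= s * (1 - l * D + (l * D) ^+ 2) by rewrite ler_pM2l.
  move/le_trans; apply; rewrite mulrDr lerD2l exprMn.
  apply: (@le_trans _ _ (l ^+ 2 * D ^+ 2)).
    by rewrite ler_piMl// mulr_ge0 ?sqr_ge0.
  by rewrite ler_wpM2l ?sqr_ge0// /second_order (le_trans D2)// lerDr.
have Q1 : (v - u) ^+ 2 * expR (- (beta / 2) * `|u|) <= second_order (beta / 2) u v.
  by rewrite /second_order lerDl; case: ifP => // _; exact: sqr_ge0.
have Du : - D <= u.
  by rewrite /D (max_r u0) opprB; have := @le_max _ _ 0 0 v; rewrite lexx/=; lra.
have sE : s * expR (l * u) <= expR (- (beta / 2) * `|u|).
  apply: (@le_trans _ _ (expR (- (beta * u)) * expR (l * u))).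
    by rewrite ler_pM2r ?expR_gt0//; exact: sigmoid_le_expR.
  by rewrite -expRD ler_expR ger0_norm//; nra.
have main : (1 - l * D) + (l * D) ^+ 2 * expR (l * u) >= expR (- (l * D)).
  have eu1 : 1 <= expR (l * u) by rewrite -expR0 ler_expR mulr_ge0.
  have [D0|D0] := lerP 0 D.
    apply: le_trans (expRN_le_ge0 (mulr_ge0 l0 D0)) _.
    by rewrite lerD2l ler_peMr// sqr_ge0.
  have lD0 : l * D <= 0 by rewrite mulr_ge0_le0// ltW.
  apply: le_trans (expRN_le_le0 lD0) _.
  by rewrite lerD2l ler_wpM2l ?sqr_ge0// ler_expR -mulrN ler_wpM2l.
apply: (@le_trans _ _ (s * ((1 - l * D) + (l * D) ^+ 2 * expR (l * u)))).
  by rewrite ler_pM2l.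
rewrite mulrDr lerD2l.
have -> : s * ((l * D) ^+ 2 * expR (l * u)) = l ^+ 2 * (D ^+ 2 * (s * expR (l * u))) by ring.
rewrite ler_wpM2l ?sqr_ge0//; apply: le_trans Q1.
by rewrite ler_pM ?sqr_ge0// mulr_ge0 ?expR_ge0 ?ltW.
Qed.

End pointwise.

(** * Moment generating function of the excess loss *)

Section excess_mean.
Context (R : realType) (dO : measure_display) (Omega : measurableType dO)
  (P : probability Omega R).
Variables (u z v : Omega -> R) (rho : R).
Hypothesis uN : std_normal P u.
Hypothesis vN : std_normal P v.
Hypothesis zN : std_normal P z \/ z = cst 0.
Hypothesis rho_ge : -1 <= rho.
Hypothesis rho_lt : rho < 1.
Let a := Num.sqrt (1 - rho ^+ 2).
Hypothesis vE : forall w, v w = rho * u w + a * z w.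
Hypothesis uz : forall f g : R -> R, measurable_fun setT f -> measurable_fun setT g ->
  (forall x, 0 <= f x) -> (forall x, 0 <= g x) ->
  (\int[P]_w (f (u w))%:E < +oo)%E -> (\int[P]_w (g (z w))%:E < +oo)%E ->
  (\int[P]_w (f (u w) * g (z w))%:E =
   \int[P]_w (f (u w))%:E * \int[P]_w (g (z w))%:E)%E.

Let mu_ : measurable_fun setT u := uN.1.
Let mv : measurable_fun setT v := vN.1.
Let mz : measurable_fun setT z.
Proof. by case: zN => [[]//|->]. Qed.

Let mean_prod (f g : R -> R) e k : measurable_fun setT f -> measurable_fun setT g ->
  (forall x, 0 <= f x) -> (forall x, 0 <= g x) ->
  has_mean P (f \o u) e -> has_mean P (g \o z) k ->
  has_mean P (fun w => f (u w) * g (z w)) (e * k).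
Proof.
move=> mf mg f0 g0 [_ fe] [_ gk].
have E : (\int[P]_w (f (u w) * g (z w))%:E = (e * k)%:E)%E.
  by rewrite uz//; [rewrite EFinM -fe -gk|rewrite fe ltry|rewrite gk ltry].
rewrite -[X in has_mean _ _ X]/(fine (e * k)%:E) -E; apply: has_mean_ge0.
- by apply: measurable_funM; exact: measurableT_comp.
- by move=> w; rewrite mulr_ge0.
- by rewrite E ltry.
Qed.

Let z_expR_abs t : 0 <= t ->
  exists2 e, has_mean P (fun w => expR (t * `|z w|)) e & e <= 2 * expR (t ^+ 2 / 2).
Proof.
move=> t0; case: zN => [zN'|->]; first exact: std_normal_expR_abs.
exists 1; last first.
  have : 1 <= expR (t ^+ 2 / 2) by rewrite -expR0 ler_expR mulr_ge0// sqr_ge0.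
  by lra.
rewrite (_ : (fun w => _) = cst 1); first exact: has_mean_cst.
by apply/funext => w; rewrite /= normr0 mulr0 expR0.
Qed.

Let abs_le_expR (x : R) : `|x| <= expR (1 * `|x|).
Proof. by rewrite mul1r; have := expR_ge1Dx `|x|; lra. Qed.

Lemma std_normal_abs_mean u' : std_normal P u' ->
  has_mean P (fun w => `|u' w|) (fine (\int[@lebesgue_measure R]_x (normal_pdf 0 1 x * `|x|)%:E)%E).
Proof.
move=> uN'; rewrite -(@std_normal_integral _ _ _ P u' Num.norm)//.
have [e he _] := std_normal_expR_abs uN' ler01.
have ma : measurable_fun setT (fun w => `|u' w|) by apply: measurableT_comp => //; exact: uN'.1.
have [w|k hk] := has_mean_dom ma he; first by rewrite normr_id abs_le_expR.
apply: has_mean_ge0 => //; by rewrite hk.2 ltry.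
Qed.

(** An explicit lower bound, uniform in beta >= 1, for the mean of the conditional
    label mean times u: the latter is at least sigmoid_bias 1 for u in [1, 2],
    where the normal density is at least its value at 2. *)
Definition signal_gap : R := sigmoid_bias 1 * normal_pdf 0 1 2.

Lemma bias_mean beta : 1 <= beta ->
  exists2 k, has_mean P (fun w => sigmoid_bias (beta * u w) * u w) k & signal_gap <= k.
Proof.
move=> beta1.
have [e he _] := std_normal_expR_abs uN ler01.
have mf : measurable_fun setT (fun w => sigmoid_bias (beta * u w) * u w).
  apply: measurable_funM => //; apply: measurableT_comp; first exact: measurable_sigmoid_bias.
  exact: measurable_funM.
have [w|k hk] := has_mean_dom mf he.
  rewrite normrM; apply: le_trans (abs_le_expR (u w)).
  by rewrite ler_piMl// sigmoid_bias_le1.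
exists k => //.
pose I : set R := `[1, 2]%classic.
have mI : measurable I by exact: measurable_itv.
have IE : (\int[P]_w (\1_I (u w))%:E = normal_prob 0 1 I)%E.
  rewrite -uN.2//; rewrite -[RHS]/(P (u @^-1` I)) -[X in P X]setIT -integral_indic//.
  by rewrite -[X in measurable X]setTI; exact: mu_.
have IN : has_mean P (fun w => \1_I (u w)) (fine (normal_prob 0 1 I)).
  rewrite -IE; apply: has_mean_ge0.
  - by apply: measurableT_comp => //; exact: measurable_indic.
  - by [].
  - by rewrite IE ltey_eq (fin_num_measure (@normal_prob R 0 1) _ mI).
have pI : normal_pdf 0 1 2 <= fine (normal_prob 0 1 I).
  rewrite -lee_fin fineK; last exact: (fin_num_measure (@normal_prob R 0 1) _ mI).
  rewrite /normal_prob; apply: (@le_trans _ _ (\int[lebesgue_measure]_(x in I) (normal_pdf 0 1 (2 : R))%:E)%E).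
    rewrite integral_cst//= lebesgue_measure_itv/= lte_fin ltr1n -EFinB.
    by rewrite (_ : 2 - 1 = 1 :> R) ?mule1//; lra.
  apply: ge0_le_integral => //.
  - by move=> x _; rewrite lee_fin normal_pdf_ge0.
  - by apply/measurable_EFinP; apply: measurable_funTS; exact: measurable_normal_pdf.
  - move=> x; rewrite /I/= in_itv/= => /andP[x1 x2]; rewrite lee_fin !normal_pdfE ?oner_eq0//.
    rewrite ler_wpM2l ?normal_peak_ge0// ler_expR !subr0 expr1n !mulNr lerN2.
    by rewrite ler_pM2r ?invr_gt0// ler_sqr ?nnegrE//; lra.
apply: (@le_trans _ _ (sigmoid_bias 1 * fine (normal_prob 0 1 I))).
  by rewrite /signal_gap ler_pM2l// sigmoid_bias1_gt0.
apply: has_mean_le (has_meanZ _ IN) hk _ => w; rewrite indicE.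
have [wI|_] := boolP (u w \in I).
  rewrite mulr1; move: wI; rewrite inE /I/= in_itv/= => /andP[w1 _].
  have b1 : sigmoid_bias 1 <= sigmoid_bias (beta * u w).
    by apply: sigmoid_bias_homo; nra.
  by have := @sigmoid_bias1_gt0 R; nra.
rewrite mulr0; have [u0|u0] := lerP 0 (u w).
  by rewrite mulr_ge0// sigmoid_bias_ge0// mulr_ge0//; lra.
rewrite -mulrNN -sigmoid_biasN mulr_ge0//; last by lra.
by rewrite sigmoid_bias_ge0//; nra.
Qed.



Let has_mean_eq f g e k : has_mean P f e -> f =1 g -> e = k -> has_mean P g k.
Proof. by move=> fe /funext <- <-. Qed.

Let pos (x : R) := Num.max x 0.
Let pos_ge0 x : 0 <= pos x. Proof. by rewrite /pos le_max lexx orbT. Qed.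
Let mpos : measurable_fun setT pos.
Proof. by apply: measurable_maxr. Qed.
Let posE x : x = pos x - pos (- x).
Proof. by rewrite /pos; case: (lerP x 0) => x0; case: (lerP (- x) 0) => x1; lra. Qed.
Let pos_le_abs x : pos x <= `|x|.
Proof. by rewrite /pos ge_max ler_norm normr_ge0. Qed.

(** z is symmetric and independent of u.  Positive and negative parts of both
    factors are separated because the product rule is available for nonnegative
    functions. *)
Lemma bias_cross_mean beta : has_mean P (fun w => sigmoid_bias (beta * u w) * z w) 0.
Proof.
pose T x := sigmoid_bias (beta * x).
have mT : measurable_fun setT T.
  by apply: measurableT_comp; [exact: measurable_sigmoid_bias|exact: measurable_funM].
have meanT (s : R -> R) : measurable_fun setT s -> (forall x, `|s x| <= 1) ->
    exists t, has_mean P (fun w => pos (s (u w))) t.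
  move=> ms s1; apply: (@has_mean_dom _ _ _ P _ (cst 1) 1 _ (has_mean_cst P 1)).
    by apply: measurableT_comp => //; exact: measurableT_comp.
  by move=> w; rewrite ger0_norm// (le_trans (pos_le_abs _)).
have [tp htp] := meanT T mT (fun x => sigmoid_bias_le1 _).
have [tm htm] := meanT (fun x => - T x) (measurableT_comp (@oppr_measurable _ _) mT)
   (ltac:(by move=> x; rewrite normrN sigmoid_bias_le1)).
have [m [hp hm]] : exists m, has_mean P (fun w => pos (z w)) m /\ has_mean P (fun w => pos (- z w)) m.
  have [zN'|z0] := zN; last first.
    have p0 : pos 0 = 0 by rewrite /pos maxxx.
    by exists 0; rewrite z0 /= oppr0 p0; split; exact: has_mean_cst.
  have mean_pos u' : std_normal P u' ->
      has_mean P (fun w => pos (u' w)) (fine (\int[@lebesgue_measure R]_x (normal_pdf 0 1 x * pos x)%:E)%E).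
    move=> uN'; rewrite -(@std_normal_integral _ _ _ P u' pos)//.
    have mp : measurable_fun setT (fun w => pos (u' w)) by apply: measurableT_comp => //; exact: uN'.1.
    have [w|k hk] := has_mean_dom mp (std_normal_abs_mean uN'); first by rewrite ger0_norm.
    by apply: has_mean_ge0 => //; rewrite hk.2 ltry.
  by eexists; split; [exact: mean_pos|apply: mean_pos (std_normal_opp zN')].
have mNT : measurable_fun setT (fun x => pos (- T x)).
  by apply: measurableT_comp => //; exact: measurableT_comp.
have mpT : measurable_fun setT (fun x => pos (T x)) by exact: measurableT_comp.
have mposN : measurable_fun setT (fun x : R => pos (- x)) by exact: measurableT_comp.
have hpp := @mean_prod (fun x => pos (T x)) pos _ _ mpT mpos (fun=> pos_ge0 _) pos_ge0 htp hp.
have hpm := @mean_prod (fun x => pos (T x)) (fun x => pos (- x)) _ _ mpT mposN (fun=> pos_ge0 _) (fun=> pos_ge0 _) htp hm.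
have hmp := @mean_prod (fun x => pos (- T x)) pos _ _ mNT mpos (fun=> pos_ge0 _) pos_ge0 htm hp.
have hmm := @mean_prod (fun x => pos (- T x)) (fun x => pos (- x)) _ _ mNT mposN (fun=> pos_ge0 _) (fun=> pos_ge0 _) htm hm.
apply: (has_mean_eq (has_meanD (has_meanD hpp (has_meanZ (-1) hpm)) (has_meanD (has_meanZ (-1) hmp) hmm))); last by ring.
by move=> w; rewrite [z w in RHS]posE [sigmoid_bias _]posE /=; rewrite -/(T (u w)); ring.
Qed.

Let r2 := 2 * (1 - rho).
Let a2E : a ^+ 2 = (1 - rho) * (1 + rho).
Proof.
have E : 1 - rho ^+ 2 = (1 - rho) * (1 + rho) by ring.
by have := rho_ge; have := rho_lt => ? ?; rewrite /a E sqr_sqrtr//; apply: mulr_ge0; lra.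
Qed.
Let a0 : 0 <= a. Proof. exact: sqrtr_ge0. Qed.
Let a2_le : a ^+ 2 <= r2.
Proof. by have := rho_ge; have := rho_lt => ? ?; rewrite a2E /r2 mulrC ler_pM2r; lra. Qed.
Let r2_gt0 : 0 < r2. Proof. by have := rho_lt => ?; rewrite /r2; lra. Qed.
Let rho2_le : (1 - rho) ^+ 2 <= r2.
Proof. by have := rho_ge; have := rho_lt => ? ?; rewrite /r2; nra. Qed.

Let measurable_second_order b : measurable_fun setT (fun w => second_order b (u w) (v w)).
Proof.
apply: measurable_funD.
  apply: measurable_funM; first by apply: measurable_funX; exact: measurable_funB.
  apply: measurableT_comp => //; apply: measurable_funM => //; exact: measurableT_comp.
apply: measurable_fun_ifT => //; last exact: measurable_funX.
by apply: measurable_fun_ler => //; exact: measurable_funM.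
Qed.

Let second_order_ge0 b w : 0 <= second_order b (u w) (v w).
Proof.
rewrite /second_order; apply: addr_ge0; first by rewrite mulr_ge0 ?sqr_ge0 ?expR_ge0.
by case: ifP => // _; exact: sqr_ge0.
Qed.

(** Here u^2 is traded for half of the decay of exp(- beta |u| / 2), using
    beta >= 1. *)
Let noise_term beta w : 1 <= beta ->
  (v w - u w) ^+ 2 * expR (- (beta / 2) * `|u w|) <=
  128 * (1 - rho) ^+ 2 * expR (- (beta / 4) * `|u w|) +
  8 * a ^+ 2 * (expR (- (beta / 2) * `|u w|) * expR (1 * `|z w|)).
Proof.
move=> b1; rewrite vE; set U := `|u w|; set Z := `|z w|.
have U0 : 0 <= U by exact: normr_ge0.
have uU : u w ^+ 2 = U ^+ 2 by rewrite /U real_normK// num_real.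
have zZ : z w ^+ 2 = Z ^+ 2 by rewrite /Z real_normK// num_real.
have h1 : (rho * u w + a * z w - u w) ^+ 2 <=
    2 * (1 - rho) ^+ 2 * U ^+ 2 + 2 * a ^+ 2 * Z ^+ 2.
  rewrite -uU -zZ -subr_ge0.
  rewrite (_ : _ - _ = ((1 - rho) * u w + a * z w) ^+ 2); first exact: sqr_ge0.
  by ring.
have h2 : U ^+ 2 * expR (- (beta / 2) * U) <= 64 * expR (- (beta / 4) * U).
  have h : U ^+ 2 <= 64 * expR (beta / 4 * U).
    have := sqr_le_expR (_ : 0 <= U / 4); rewrite expr_div_n => /(_ ltac:(lra)) h.
    apply: (@le_trans _ _ (64 * expR (U / 4))); first by lra.
    by rewrite ler_pM2l// ler_expR; nra.
  have -> : expR (- (beta / 4) * U) = expR (beta / 4 * U) * expR (- (beta / 2) * U).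
    by rewrite -expRD; congr expR; field.
  by rewrite mulrA ler_pM2r// expR_gt0.
have h3 : Z ^+ 2 <= 4 * expR (1 * Z) by rewrite mul1r; apply: sqr_le_expR; exact: normr_ge0.
set e2 := expR (- (beta / 2) * U) in h2 *.
have e2_0 : 0 < e2 by exact: expR_gt0.
apply: (@le_trans _ _ ((2 * (1 - rho) ^+ 2 * U ^+ 2 + 2 * a ^+ 2 * Z ^+ 2) * e2)).
  by rewrite ler_pM2r.
rewrite mulrDl; apply: lerD.
  have c0 : 0 <= 2 * (1 - rho) ^+ 2 by rewrite mulr_ge0 ?sqr_ge0.
  by have := ler_wpM2l c0 h2; lra.
have c0 : 0 <= 2 * a ^+ 2 * e2 by rewrite !mulr_ge0 ?sqr_ge0// ltW.
by have := ler_wpM2l c0 h3; lra.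
Qed.

(** If u and v have opposite signs then |v| <= a |z|, and |u| <= 2 a |z| as
    rho >= 1/2.  The
    indicator of the latter is bounded by exp(|z| - |u| / (2 a)), so that the bound
    splits into a function of u times a function of z. *)
Let crossing_term w : 2^-1 <= rho ->
  (if u w * v w <= 0 then v w ^+ 2 else 0) <=
  4 * a ^+ 2 * (expR (- (2 * a)^-1 * `|u w|) * expR (2 * `|z w|)).
Proof.
move=> rho2; have R0 : 0 <= 4 * a ^+ 2 * (expR (- (2 * a)^-1 * `|u w|) * expR (2 * `|z w|)).
  by rewrite !mulr_ge0 ?sqr_ge0 ?expR_ge0.
case: ifP => // uv0.
have a_gt0 : 0 < a.
  rewrite lt_neqAle a0 andbT eq_sym -sqrf_eq0 a2E; have := rho_lt => ?.
  by apply: mulf_neq0; rewrite gt_eqF//; lra.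
set U := `|u w| in R0 *; set Z := `|z w| in R0 *; set V := `|v w|.
have U0 : 0 <= U by exact: normr_ge0.
have V0 : 0 <= V by exact: normr_ge0.
have Z0 : 0 <= Z by exact: normr_ge0.
have uU : u w ^+ 2 = U ^+ 2 by rewrite /U real_normK// num_real.
have vV : v w ^+ 2 = V ^+ 2 by rewrite /V real_normK// num_real.
have zZ : z w ^+ 2 = Z ^+ 2 by rewrite /Z real_normK// num_real.
have uz_le : - (u w * z w) <= U * Z by rewrite /U /Z -normrM -normrN ler_norm.
have vz_le : v w * z w <= V * Z by rewrite /V /Z -normrM ler_norm.
have VaZ : V <= a * Z.
  have [->|Vn0] := eqVneq V 0; first by rewrite mulr_ge0.
  have Vp : 0 < V by rewrite lt_neqAle eq_sym Vn0.
  rewrite -(ler_pM2l Vp) -expr2 -vV expr2 {2}vE.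
  have : v w * (rho * u w + a * z w) = rho * (u w * v w) + a * (v w * z w) by ring.
  move=> ->.
  have : rho * (u w * v w) <= 0 by apply: mulr_ge0_le0; lra.
  have : a * (v w * z w) <= a * (V * Z) by rewrite ler_pM2l.
  lra.
have UaZ : U <= 2 * a * Z.
  have [->|Un0] := eqVneq U 0; first by rewrite !mulr_ge0.
  have Up : 0 < U by rewrite lt_neqAle eq_sym Un0.
  rewrite -(ler_pM2l Up) -expr2.
  have : u w * v w = rho * U ^+ 2 + a * (u w * z w) by rewrite vE -uU; ring.
  have : a * - (u w * z w) <= a * (U * Z) by rewrite ler_pM2l.
  have : 2^-1 * U ^+ 2 <= rho * U ^+ 2 by rewrite ler_pM2r// exprn_gt0.
  lra.
rewrite vV; apply: (@le_trans _ _ (a ^+ 2 * Z ^+ 2)).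
  by rewrite -exprMn ler_sqr// nnegrE mulr_ge0.
have e1 : 1 <= expR (Z - (2 * a)^-1 * U).
  by rewrite -[leLHS]expR0 ler_expR subr_ge0 ler_pdivrMl// mulr_gt0.
have -> : expR (- (2 * a)^-1 * U) * expR (2 * Z) = expR Z * expR (Z - (2 * a)^-1 * U).
  by rewrite -!expRD; congr expR; ring.
have -> : 4 * a ^+ 2 * (expR Z * expR (Z - (2 * a)^-1 * U)) =
  a ^+ 2 * ((4 * expR Z) * expR (Z - (2 * a)^-1 * U)) by ring.
rewrite ler_wpM2l ?sqr_ge0//; apply: le_trans (sqr_le_expR Z0) _.
by rewrite ler_peMr// mulr_ge0// expR_ge0.
Qed.


(** Away from theta_star, that is for rho < 1/2, r is at least 1 and the crude bound
    v^2 suffices for the sign change.  Otherwise the mean of exp(- |u| / (2 a)) is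
    O(a), which turns a^2 into a^3. *)
Let second_order_mean beta : 1 <= beta ->
  exists2 e, has_mean P (fun w => second_order (beta / 2) (u w) (v w)) e &
    e <= 1152 * r2 * (beta^-1 + Num.sqrt r2).
Proof.
move=> b1; have b0 : 0 < beta by lra.
have rl := rho_lt.
have [e4 he4 le4] := @std_normal_expR_Nabs _ _ _ P u (beta / 4) uN (divr_gt0 b0 (ltr0n _ 4)).
have [e2 he2 le2] := @std_normal_expR_Nabs _ _ _ P u (beta / 2) uN (divr_gt0 b0 (ltr0n _ 2)).
have [z1 hz1 lz1] := z_expR_abs ler01.
have exph : expR (1 ^+ 2 / 2) <= 2 :> R by rewrite expr1n mul1r expR_half_le2.
have exp2 : expR (2 ^+ 2 / 2) <= 16 :> R.
  have -> : expR (2 ^+ 2 / 2) = expR (2^-1) ^+ 4 :> R.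
    by rewrite -expRM_natl; congr expR; field.
  have := @expR_half_le2 R; have := expR_gt0 (2^-1 : R); move: (expR _) => y y0 y2.
  have : y ^+ 2 <= 4 by nra.
  by rewrite (_ : y ^+ 4 = (y ^+ 2) ^+ 2); [nra|ring].
have mexp t : measurable_fun setT (fun x : R => expR (t * `|x|)).
  by apply: measurableT_comp => //; apply: measurable_funM.
have hcross := @mean_prod (fun x => expR (- (beta / 2) * `|x|)) (fun x => expR (1 * `|x|)) _ _
  (mexp _) (mexp _) (fun=> expR_ge0 _) (fun=> expR_ge0 _) he2 hz1.
have hnoise := has_meanD (has_meanZ (128 * (1 - rho) ^+ 2) he4) (has_meanZ (8 * a ^+ 2) hcross).
have e2_0 : 0 <= e2.
  by apply: (has_mean_le (has_mean_cst P 0) he2) => w; exact: expR_ge0.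
have z1_0 : 0 <= z1.
  by apply: (has_mean_le (has_mean_cst P 0) hz1) => w; exact: expR_ge0.
have bi0 : 0 < beta^-1 by rewrite invr_gt0.
have {}le4 : e4 <= 8 * beta^-1 by rewrite invf_div in le4; lra.
have {}le2 : e2 <= 4 * beta^-1 by rewrite invf_div in le2; lra.
have noise_le : 128 * (1 - rho) ^+ 2 * e4 + 8 * a ^+ 2 * (e2 * z1) <= 1152 * r2 * beta^-1.
  have h1 : (1 - rho) ^+ 2 * e4 <= r2 * (8 * beta^-1).
    apply: (@le_trans _ _ ((1 - rho) ^+ 2 * (8 * beta^-1))); first by rewrite ler_wpM2l ?sqr_ge0.
    by rewrite ler_wpM2r// mulr_ge0// ltW.
  have h2 : e2 * z1 <= 4 * beta^-1 * 4.
    by apply: ler_pM => //; lra.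
  have h3 : a ^+ 2 * (e2 * z1) <= r2 * (4 * beta^-1 * 4).
    by apply: ler_pM => //; rewrite ?sqr_ge0// mulr_ge0.
  lra.
have [H [h [hH leH crossH]]] : exists H e, [/\ has_mean P H e, e <= 512 * r2 * Num.sqrt r2 &
    forall w, (if u w * v w <= 0 then v w ^+ 2 else 0) <= H w].
  have s2 : Num.sqrt r2 ^+ 2 = r2 by rewrite sqr_sqrtr// ltW.
  have s0 : 0 <= Num.sqrt r2 by exact: sqrtr_ge0.
  have [rho2|rho2] := lerP 2^-1 rho.
    have a_gt0 : 0 < a.
      rewrite lt_neqAle a0 andbT eq_sym -sqrf_eq0 a2E.
      by apply: mulf_neq0; rewrite gt_eqF//; lra.
    have ai0 : 0 < (2 * a)^-1 by rewrite invr_gt0 mulr_gt0.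
    have [ea hea lea] := std_normal_expR_Nabs uN ai0.
    have [z2 hz2 lz2] := @z_expR_abs 2 (ltac:(lra)).
    have hc := @mean_prod (fun x => expR (- (2 * a)^-1 * `|x|)) (fun x => expR (2 * `|x|)) _ _
       (mexp _) (mexp _) (fun=> expR_ge0 _) (fun=> expR_ge0 _) hea hz2.
    eexists; eexists; split; [exact: (has_meanZ (4 * a ^+ 2) hc)| |].
      have ea0 : 0 <= ea.
        by apply: (has_mean_le (has_mean_cst P 0) hea) => w; exact: expR_ge0.
      have z20 : 0 <= z2.
        by apply: (has_mean_le (has_mean_cst P 0) hz2) => w; exact: expR_ge0.
      rewrite invrK in lea.
      have h1 : ea * z2 <= (4 * a) * 32 by apply: ler_pM => //; lra.
      have aS : a <= Num.sqrt r2 by rewrite -ler_sqr ?nnegrE// s2.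
      have h2 : a ^+ 2 * (ea * z2) <= a ^+ 2 * (4 * a * 32) by rewrite ler_wpM2l ?sqr_ge0.
      have h3 : a ^+ 2 * a <= r2 * Num.sqrt r2 by rewrite ler_pM ?sqr_ge0.
      lra.
    by move=> w; exact: crossing_term.
  have [ev hev lev] := std_normal_expR_abs vN ler01.
  eexists; eexists; split; [exact: (has_meanZ 4 hev)| |].
    have r21 : 1 <= r2 by rewrite /r2; lra.
    have S1 : 1 <= Num.sqrt r2 by rewrite -sqrtr1 ler_wsqrtr.
    have : 1 <= r2 * Num.sqrt r2 by rewrite -[leLHS]mulr1 ler_pM.
    lra.
  move=> w /=; have h : v w ^+ 2 <= 4 * expR (1 * `|v w|).
    by rewrite mul1r -real_normK ?num_real// sqr_le_expR.
  case: ifP => // _; rewrite mulr_ge0// expR_ge0.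
have hF := has_meanD hnoise hH.
have [|e he] := has_mean_dom (measurable_second_order (beta / 2)) hF.
  move=> w; rewrite ger0_norm ?second_order_ge0//; apply: lerD; last exact: crossH.
  exact: noise_term.
exists e => //; apply: le_trans (has_mean_le he hF _) _.
  move=> w; apply: lerD; last exact: crossH.
  exact: noise_term.
rewrite mulrDr; apply: lerD => //; apply: le_trans leH _.
have : 0 <= r2 * Num.sqrt r2 by rewrite mulr_ge0// ?sqrtr_ge0// ltW.
lra.
Qed.

(** First order: signal_gap * r2 / 4 from the label bias.  Second order: twice the
    bound on second_order, once for each label. *)
Lemma excess_mgf_le beta l : 1 <= beta -> 0 <= l -> l <= beta / 2 ->
  (\int[P]_w (sigmoid (beta * u w) *
      expR (- (l * (Num.max 0 (- v w) - Num.max 0 (- u w)))) +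
    sigmoid (- (beta * u w)) *
      expR (- (l * (Num.max 0 (v w) - Num.max 0 (u w)))))%:E <=
   (1 - l * signal_gap * r2 / 4 + 2304 * l ^+ 2 * r2 * (beta^-1 + Num.sqrt r2))%:E)%E.
Proof.
move=> b1 l0 lb.
have [k hk lek] := bias_mean b1.
have [q hq leq] := second_order_mean b1.
have hu := std_normal_abs_mean uN; have hv := std_normal_abs_mean vN.
set A := fine _ in hu hv.
have hx := bias_cross_mean beta.
have hG := has_meanD (has_mean_cst P 1)
  (has_meanD (has_meanD (has_meanZ (l / 2) hu) (has_meanZ (- (l / 2)) hv))
  (has_meanD (has_meanD (has_meanZ (- (l / 2) * (1 - rho)) hk) (has_meanZ (l / 2 * a) hx))
    (has_meanZ (2 * l ^+ 2) hq))).
apply: (@le_trans _ _ (1 + (l / 2 * A + - (l / 2) * A + (- (l / 2) * (1 - rho) * k + l / 2 * a * 0 + 2 * l ^+ 2 * q)))%:E); last first.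
  rewrite lee_fin; have rl := rho_lt.
  have h1 : l / 2 * (1 - rho) * signal_gap <= l / 2 * (1 - rho) * k.
    by rewrite ler_wpM2l// mulr_ge0//; lra.
  have h2 : 2 * l ^+ 2 * q <= 2 * l ^+ 2 * (1152 * r2 * (beta^-1 + Num.sqrt r2)).
    by rewrite ler_wpM2l// mulr_ge0 ?sqr_ge0.
  have -> : l * signal_gap * r2 / 4 = l / 2 * (1 - rho) * signal_gap by rewrite /r2; field.
  lra.
apply: integral_le_mean hG.
  have msig t : measurable_fun setT (fun w => sigmoid (t * u w)).
    by apply: measurableT_comp; [exact: measurable_sigmoid|exact: measurable_funM].
  have mrelu t : measurable_fun setT (fun w =>
      expR (- (l * (Num.max 0 (t * v w) - Num.max 0 (t * u w))))).
    apply: measurableT_comp => //; apply: measurableT_comp => //; apply: measurable_funM => //.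
    apply: measurable_funB; apply: measurable_maxr => //; exact: measurable_funM.
  have := measurable_funD (measurable_funM (msig beta) (mrelu (-1)))
    (measurable_funM (msig (- beta)) (mrelu 1)).
  apply: eq_measurable_fun => w _ /=.
  by rewrite !mul1r !mulN1r mulNr.
move=> w; apply/andP; split.
  by rewrite addr_ge0// mulr_ge0 ?expR_ge0// ltW// sigmoid_gt0.
have h1 := excess_expR_le (u w) (v w) l0 lb.
have := excess_expR_le (- u w) (- v w) l0 lb.
rewrite second_orderN mulrN opprK => h2.
apply: le_trans (lerD h2 h1) _.
have pE (x : R) : Num.max 0 x = (`|x| + x) / 2.
  by case: (lerP 0 x) => x0; [rewrite ger0_norm//|rewrite ltr0_norm//]; field.
rewrite !pE !normrN sigmoidN.
have hz : a * (sigmoid_bias (beta * u w) * z w) = sigmoid_bias (beta * u w) * (v w - rho * u w).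
  by rewrite vE; ring.
rewrite -[l / 2 * a * _]mulrA hz.
have -> : sigmoid_bias (beta * u w) = 2 * sigmoid (beta * u w) - 1.
  by rewrite /sigmoid_bias sigmoidN; ring.
rewrite le_eqVlt; apply/orP; left; apply/eqP; by field.
Qed.

End excess_mean.

(** * Integrating out the label *)

Section logistic.
Context (R : realType) (dO : measure_display) (Omega : measurableType dO)
  (P : probability Omega R) (d : nat) (beta : R) (theta : 'rV[R]_d)
  (X : Omega -> 'rV[R]_d) (Y : Omega -> R).
Hypothesis mX : measurable_fun setT X.
Hypothesis mY : measurable_fun setT Y.
Hypothesis XY : logistic_model P beta theta X Y.

Let Y01 := let: And3 _ H _ := XY in H.
Let XYsig := let: And3 _ _ H := XY in H.

Let mXA A : measurable A -> measurable (X @^-1` A).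
Proof. by move=> mA; rewrite -[X in measurable X]setTI; exact: mX. Qed.

Let mYA A : measurable A -> measurable (Y @^-1` A).
Proof. by move=> mA; rewrite -[X in measurable X]setTI; exact: mY. Qed.

Let sig w := sigmoid (beta * dot (X w) theta).
Let msig : measurable_fun setT sig.
Proof.
apply: measurableT_comp; first exact: measurable_sigmoid.
apply: measurable_funM => //.
exact: (measurableT_comp (@measurable_dot R d theta)).
Qed.

Let one_neq : (1 : R) <> -1. Proof. by move=> h; lra. Qed.

Let label (y : R) : set Omega := Y @^-1` [set y].
Let mlabel y : measurable (label y). Proof. exact: mYA. Qed.

Let weight_pos A : measurable A ->
  (\int[P]_(w in X @^-1` A) (\1_(label 1) w)%:E = \int[P]_(w in X @^-1` A) (sig w)%:E)%E.
Proof.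
move=> mA; rewrite integral_indic//; last exact: mXA.
by rewrite setIC -XYsig.
Qed.

(** Only the weight of the label 1 is given by the model; the label -1 takes the
    rest. *)
Let weight_neg A : measurable A ->
  (\int[P]_(w in X @^-1` A) (\1_(label (-1)) w)%:E = \int[P]_(w in X @^-1` A) (1 - sig w)%:E)%E.
Proof.
move=> mA; have mXA' := mXA mA.
have sum1 : (\int[P]_(w in X @^-1` A) (\1_(label 1) w)%:E +
    \int[P]_(w in X @^-1` A) (\1_(label (-1)) w)%:E = P (X @^-1` A))%E.
  rewrite -ge0_integralD//.
  - rewrite -[RHS]mul1e -integral_cst//; apply: eq_integral => w _.
    rewrite -EFinD !indicE /label; case: (Y01 w) => Yw.
      rewrite mem_set// memNset ?addr0//= Yw; exact: one_neq.
    by rewrite memNset ?mem_set ?add0r//= Yw => /esym; exact: one_neq.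
  - by apply/measurable_EFinP; exact: measurable_indic.
  - by apply/measurable_EFinP; exact: measurable_indic.
have sum2 : (\int[P]_(w in X @^-1` A) (sig w)%:E +
    \int[P]_(w in X @^-1` A) (1 - sig w)%:E = P (X @^-1` A))%E.
  rewrite -ge0_integralD//.
  - rewrite -[RHS]mul1e -integral_cst//; apply: eq_integral => w _.
    by rewrite -EFinD addrC subrK.
  - by move=> w _; rewrite lee_fin ltW// sigmoid_gt0.
  - by apply/measurable_EFinP; exact: measurable_funTS.
  - by move=> w _; rewrite lee_fin subr_ge0 sigmoid_le1.
  - by apply/measurable_EFinP; apply: measurable_funTS; exact: measurable_funB.
have fin : (\int[P]_(w in X @^-1` A) (sig w)%:E)%E \is a fin_num.
  by rewrite -weight_pos// integral_indic// fin_num_measure//; exact: measurableI.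
rewrite -[LHS](addeK _ fin) -[RHS](addeK _ fin); congr (_ - _)%E.
by rewrite addeC -[in LHS]weight_pos// sum1 -sum2 addeC.
Qed.

Lemma logistic_integral (f : 'rV[R]_d -> R -> R) :
  measurable_fun setT (f^~ 1) -> measurable_fun setT (f^~ (-1)) ->
  (forall x y, 0 <= f x y) ->
  (\int[P]_w (f (X w) (Y w))%:E =
   \int[P]_w (sig w * f (X w) 1 + sigmoid (- (beta * dot (X w) theta)) * f (X w) (-1))%:E)%E.
Proof.
move=> m1 mN1 f0.
have mf1 : measurable_fun setT (fun w => f (X w) 1) by exact: measurableT_comp m1 mX.
have mfN1 : measurable_fun setT (fun w => f (X w) (-1)) by exact: measurableT_comp mN1 mX.
have sig0 w : 0 <= sig w by rewrite ltW// sigmoid_gt0.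
have sig1 w : 0 <= 1 - sig w by rewrite subr_ge0 sigmoid_le1.
have m1sig : measurable_fun setT (fun w => 1 - sig w) by exact: measurable_funB.
transitivity (\int[P]_w ((\1_(label 1) w * f (X w) 1)%:E + (\1_(label (-1)) w * f (X w) (-1))%:E))%E.
  apply: eq_integral => w _; rewrite -EFinD !indicE /label; congr _%:E.
  case: (Y01 w) => Yw; rewrite Yw.
    rewrite mem_set// memNset ?mul0r ?addr0 ?mul1r//= Yw; exact: one_neq.
  rewrite memNset ?mem_set// ?mul0r ?add0r ?mul1r//= Yw => /esym; exact: one_neq.
rewrite ge0_integralD//; last 4 first.
- by move=> w _; rewrite lee_fin mulr_ge0.
- by apply/measurable_EFinP; apply: measurable_funM => //; exact: measurable_indic.
- by move=> w _; rewrite lee_fin mulr_ge0.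
- by apply/measurable_EFinP; apply: measurable_funM => //; exact: measurable_indic.
rewrite (@integral_weighted_transferR _ _ _ _ _ _ _ P P X X _ sig (f^~ 1))//.
rewrite (@integral_weighted_transferR _ _ _ _ _ _ _ P P X X _ (fun w => 1 - sig w) (f^~ (-1)))//.
rewrite -ge0_integralD//.
- by apply: eq_integral => w _; rewrite sigmoidN -EFinD.
- by move=> w _; rewrite lee_fin mulr_ge0.
- by apply/measurable_EFinP; exact: measurable_funM.
- by move=> w _; rewrite lee_fin mulr_ge0.
- by apply/measurable_EFinP; exact: measurable_funM.
Qed.

End logistic.

(** * Concentration of sums *)

Section chernoff.
Context (R : realType) (dO dT : measure_display) (Omega : measurableType dO)
  (T : measurableType dT) (P : probability Omega R) (n : nat) (Z : 'I_n -> Omega -> T).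
Hypothesis mZ : forall i, measurable_fun setT (Z i).
Hypothesis indZ : mutually_independent P Z.

(** Markov's inequality for the exponential of the sum, which factorizes. *)
Lemma chernoff_ge (h : T -> R) (q t : R) :
  measurable_fun setT h ->
  (forall i, \int[P]_w (expR (h (Z i w)))%:E <= (expR q)%:E)%E ->
  (P [set w | (t <= \sum_(i < n) h (Z i w))%R] <= (expR (n%:R * q - t))%:E)%E.
Proof.
move=> mh hq; set E := [set w | _].
have mhZ i : measurable_fun setT (fun w => h (Z i w)) by exact: measurableT_comp.
have mS : measurable_fun setT (fun w => \sum_(i < n) h (Z i w)) by exact: measurable_sum.
have mE : measurable E.
  rewrite (_ : E = (fun w => \sum_(i < n) h (Z i w)) @^-1` `[t, +oo[%classic).
    by rewrite -[X in measurable X]setTI; apply: mS.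
  by apply/seteqP; split=> w; rewrite /E /= in_itv/= andbT.
apply: (@le_trans _ _ (\int[P]_w ((expR (- t))%:E * (\prod_(i < n) expR (h (Z i w)))%:E)))%E.
  rewrite -[X in (P X <= _)%E]setIT -integral_indic//; apply: ge0_le_integral => //.
  - by apply/measurable_EFinP; exact: measurable_indic.
  - apply: emeasurable_funM => //; apply/measurable_EFinP.
    by apply: measurable_prod => i _; exact: measurableT_comp.
  - move=> w _; rewrite -EFinM lee_fin indicE -expR_sum -expRD.
    case: (boolP (w \in E)) => [/set_mem wE|_]; last exact: expR_ge0.
    by rewrite -[leLHS]expR0 ler_expR addrC subr_ge0.
have mprod : measurable_fun setT (fun w => (\prod_(i < n) expR (h (Z i w)))%:E).
  by apply/measurable_EFinP; apply: measurable_prod => i _; exact: measurableT_comp.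
have prod0 w : (0 <= (\prod_(i < n) expR (h (Z i w)))%:E)%E.
  by rewrite lee_fin; apply: prodr_ge0 => i _; exact: expR_ge0.
rewrite ge0_integralZl ?lee_fin ?expR_ge0//.
rewrite (@independent_integral_prod _ _ _ _ _ P _ Z mZ indZ (fun _ x => expR (h x))).
- rewrite (_ : expR (n%:R * q - t) = expR (- t) * \prod_(i < n) expR q); last first.
    by rewrite -expR_sum -expRD sumr_const card_ord mulr_natl addrC.
  rewrite EFinM lee_wpmul2l ?lee_fin ?expR_ge0//.
  have ge0 i : (0 <= \int[P]_w (expR (h (Z i w)))%:E)%E.
    by apply: integral_ge0 => w _; rewrite lee_fin expR_ge0.
  have fin i : (\int[P]_w (expR (h (Z i w)))%:E)%E \is a fin_num.
    by rewrite ge0_fin_numE// (le_lt_trans (hq i))// ltry.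
  under eq_bigr => i _ do rewrite -(fineK (fin i)).
  rewrite prodEFin lee_fin; apply: ler_prod => i _.
  by rewrite fine_ge0//= -lee_fin fineK.
- by move=> i; exact: measurableT_comp.
- by move=> i x; exact: expR_ge0.
- by move=> i; apply: le_lt_trans (hq i) (ltry _).
Qed.

End chernoff.

Section dot_facts.
Context {R : realType} {d : nat}.
Implicit Types u v : 'rV[R]_d.

Lemma dot_ge0 u : 0 <= dot u u.
Proof. by apply: sumr_ge0 => j _; rewrite -expr2 sqr_ge0. Qed.

Lemma unit_sphereE u : unit_sphere R d u -> dot u u = 1.
Proof.
by rewrite /unit_sphere/= /enorm => u1; rewrite -(sqr_sqrtr (dot_ge0 u)) u1 expr1n.
Qed.

Lemma dotDD u v (s : R) : s ^+ 2 = 1 ->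
  dot (u + s *: v) (u + s *: v) = dot u u + dot v v + 2 * s * dot u v.
Proof.
move=> s1; have -> : dot v v = s ^+ 2 * dot v v by rewrite s1 mul1r.
rewrite /dot !mulr_sumr -!big_split/=.
by apply: eq_bigr => j _; rewrite !mxE; ring.
Qed.

Lemma unit_dot_ge u v : unit_sphere R d u -> unit_sphere R d v -> -1 <= dot u v.
Proof.
move=> /unit_sphereE u1 /unit_sphereE v1.
have := dot_ge0 (u + 1 *: v); rewrite dotDD ?expr1n// u1 v1; lra.
Qed.

Lemma enorm_sub_unit u v : unit_sphere R d u -> unit_sphere R d v ->
  enorm (v - u) = Num.sqrt (2 * (1 - dot u v)).
Proof.
move=> /unit_sphereE u1 /unit_sphereE v1; rewrite /enorm -scaleN1r dotDD ?sqrrN ?expr1n//.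
by rewrite u1 v1 dotC; congr Num.sqrt; ring.
Qed.
End dot_facts.

Section gap.
Context {R : realType}.
Lemma signal_gap_gt0 : 0 < signal_gap R.
Proof.
rewrite /signal_gap mulr_gt0 ?sigmoid_bias1_gt0// normal_pdfE ?oner_eq0//.
by rewrite mulr_gt0 ?expR_gt0// normal_peak_gt0// oner_eq0.
Qed.

Lemma signal_gap_le1 : signal_gap R <= 1.
Proof.
rewrite /signal_gap -[leRHS]mulr1 ler_pM ?normal_pdf_ge0 ?(ltW sigmoid_bias1_gt0)//.
  by apply: le_trans (sigmoid_bias_le1 1); exact: ler_norm.
by apply: le_trans (normal_pdf_ub _ _ _) (normal_peak1_le1 R); exact: oner_neq0.
Qed.
End gap.

(** Twice the constant of second_order_mean, one share for each label. *)
Definition noise_const (R : realType) : R := 2304%:R.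

Lemma noise_const_ge1 (R : realType) : 1 <= noise_const R.
Proof. by rewrite /noise_const ler1n. Qed.

Definition excess (R : realType) d (ts th : 'rV[R]_d) (z : 'rV[R]_d * R) : R :=
  Num.max 0 (- z.2 * dot z.1 th) - Num.max 0 (- z.2 * dot z.1 ts).

Lemma measurable_excess (R : realType) d (ts th : 'rV[R]_d) : measurable_fun setT (excess ts th).
Proof.
have md a : measurable_fun setT (fun z : 'rV[R]_d * R => - z.2 * dot z.1 a).
  apply: measurable_funM; first exact: measurableT_comp.
  exact: (measurableT_comp (@measurable_dot R d a)).
by apply: measurable_funB; apply: measurable_maxr.
Qed.

Section direction.
Context (R : realType) (dO : measure_display) (Omega : measurableType dO)
  (P : probability Omega R) (d : nat) (beta : R) (ts : 'rV[R]_d).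
Hypothesis ts1 : unit_sphere R d ts.
Hypothesis beta1 : 1 <= beta.
Notation gap := (signal_gap R).

Lemma excess_mgf_unit (X : Omega -> 'rV[R]_d) (Y : Omega -> R) (th : 'rV[R]_d) (l : R) :
  measurable_fun setT X -> measurable_fun setT Y -> logistic_model P beta ts X Y ->
  unit_sphere R d th -> dot ts th < 1 -> 0 <= l -> l <= beta / 2 ->
  (\int[P]_w (expR (- (l * excess ts th (X w, Y w))))%:E <=
   (1 - l * gap * (2 * (1 - dot ts th)) / 4 + noise_const R * l ^+ 2 * (2 * (1 - dot ts th)) *
      (beta^-1 + Num.sqrt (2 * (1 - dot ts th))))%:E)%E.
Proof.
move=> mX mY XY th1 rho1 l0 lb.
have XN : standard_normal_vector P X by case: XY.
have [uN [z [zN vE uz]]] := gaussian_projections mX XN (unit_sphereE ts1) (unit_sphereE th1).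
have [vN _] := gaussian_projections mX XN (unit_sphereE th1) (unit_sphereE ts1).
pose f x y := expR (- (l * excess ts th (x, y))).
have mf y : measurable_fun setT (f^~ y).
  apply: measurableT_comp => //; apply: measurableT_comp => //; apply: measurable_funM => //.
  by apply: (measurableT_comp (measurable_excess ts th)); exact: measurable_fun_pair.
rewrite (@logistic_integral _ _ _ P d beta ts X Y mX mY XY f)//; last first.
  by move=> x y; exact: expR_ge0.
have := excess_mgf_le uN vN zN (unit_dot_ge ts1 th1) rho1 vE uz beta1 l0 lb.
apply: le_trans; rewrite le_eqVlt; apply/orP; left; apply/eqP.
apply: eq_integral => w _.
by rewrite /f /excess /= !mulN1r !opprK !mul1r.
Qed.

Context (n : nat) (X : 'I_n -> Omega -> 'rV[R]_d) (Y : 'I_n -> Omega -> R).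
Hypothesis mX : forall i, measurable_fun setT (X i).
Hypothesis mY : forall i, measurable_fun setT (Y i).
Hypothesis XY : logistic_sample P beta ts X Y.

(** With the tilt l = signal_gap / (8 noise_const (1 / beta + r)) the second-order
    term is half of the first-order one, which leaves exp(- l signal_gap r^2 / 8)
    per observation.  Half of that exponent is spent on the margin. *)
Lemma excess_sum_le (th : 'rV[R]_d) (eps : R) :
  unit_sphere R d th -> 0 < eps -> eps <= enorm (th - ts) ->
  (P [set w | (\sum_(i < n) excess ts th (X i w, Y i w) <= n%:R * (gap / 16 * eps ^+ 2))%R] <=
   (expR (- (n%:R * (gap ^+ 2 / (noise_const R * 128)) / ((beta * eps ^+ 2)^-1 + eps^-1))))%:E)%E.
Proof.
move=> th1 eps0; rewrite (enorm_sub_unit ts1 th1) => epsr.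
have g0 : 0 < gap := signal_gap_gt0; have g1 : gap <= 1 := signal_gap_le1.
(* From here on only a lower bound on noise_const matters. *)
have [K KE] : exists K, noise_const R = K by exists (noise_const R).
have K1 : 1 <= K by rewrite -KE; exact: noise_const_ge1.
have K0 : 0 < K by exact: lt_le_trans K1.
have Kn0 : K != 0 by rewrite gt_eqF.
rewrite KE.
have b0 : 0 < beta by apply: lt_le_trans beta1.
set r2 := 2 * _ in epsr; set r := Num.sqrt r2 in epsr.
have r_gt0 : 0 < r by exact: lt_le_trans epsr.
have r2_gt0 : 0 < r2 by rewrite -sqrtr_gt0.
have rr : r ^+ 2 = r2 by rewrite sqr_sqrtr// ltW.
have rho1 : dot ts th < 1 by move: r2_gt0; rewrite /r2; lra.
have bi0 : 0 < beta^-1 by rewrite invr_gt0.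
pose D := beta^-1 + r; have D0 : 0 < D by rewrite addr_gt0.
pose l := gap / (K * 8) / D.
have lD : l * D = gap / (K * 8) by rewrite divfK// gt_eqF.
have c0 : 0 < gap / (K * 8) by rewrite divr_gt0// mulr_gt0.
have l0 : 0 < l by rewrite divr_gt0.
have lb : l <= beta / 2.
  rewrite ler_pdivrMr//; apply: (@le_trans _ _ (2^-1 * (beta * beta^-1))).
    rewrite mulfV ?gt_eqF// mulr1 ler_pdivrMr ?mulr_gt0//.
    lra.
  have : 0 <= beta * r by rewrite mulr_ge0// ltW.
  by rewrite /D; lra.
have eps2 : eps ^+ 2 <= r2 by rewrite -rr ler_sqr// nnegrE ltW.
pose q := - (l * gap * r2 / 8).
have hq i : (\int[P]_w (expR (- (l * excess ts th (X i w, Y i w))))%:E <= (expR q)%:E)%E.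
  apply: le_trans (excess_mgf_unit (mX i) (mY i) (XY.2 i) th1 rho1 (ltW l0) lb) _.
  rewrite KE lee_fin; apply: le_trans (expR_ge1Dx q).
  rewrite -/r2 -/r -/D /q.
  have -> : K * l ^+ 2 * r2 * D = l * r2 * (K * (l * D)) by ring.
  have -> : K * (l * D) = gap / 8 by rewrite lD; field.
  by lra.
have mZ i : measurable_fun setT (fun w => (X i w, Y i w)) by exact: measurable_fun_pair.
have mh : measurable_fun setT (fun z => - (l * excess ts th z)).
  by apply: measurableT_comp => //; apply: measurable_funM => //; exact: measurable_excess.
have := @chernoff_ge _ _ _ _ _ P n _ mZ XY.1 _ q (- (l * (n%:R * (gap / 16 * eps ^+ 2)))) mh hq.
rewrite (_ : [set w | _] = [set w | (\sum_(i < n) excess ts th (X i w, Y i w) <= n%:R * (gap / 16 * eps ^+ 2))%R]); last first.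
  by apply/seteqP; split=> w /=; rewrite sumrN -mulr_sumr lerN2 ler_pM2l.
move/le_trans; apply; rewrite lee_fin ler_expR.
(* l r^2 increases with r, so r >= eps gives the rate at distance eps. *)
have lr : gap / (K * 8) / ((beta * eps ^+ 2)^-1 + eps^-1) <= l * r2.
  rewrite /l -[leRHS]mulrA ler_pM2l// ler_pdivlMl//.
  rewrite ler_pdivrMr; last by rewrite addr_gt0// invr_gt0// mulr_gt0// exprn_gt0.
  have h1 : beta^-1 <= r2 * (beta * eps ^+ 2)^-1.
    have e1 : 1 <= r2 * (eps ^+ 2)^-1 by rewrite ler_pdivlMr ?mul1r// exprn_gt0.
    by rewrite invfM mulrCA; apply: ler_peMr => //; exact: ltW.
  have h2 : r <= r2 * eps^-1.
    by rewrite ler_pdivlMr// -rr expr2 ler_pM2l.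
  by rewrite /D mulrDr lerD.
have n0 : 0 <= n%:R :> R by [].
have -> : n%:R * (gap ^+ 2 / (K * 128)) / ((beta * eps ^+ 2)^-1 + eps^-1) =
  n%:R * (gap / 16) * (gap / (K * 8) / ((beta * eps ^+ 2)^-1 + eps^-1)).
  by rewrite -mulrA -[RHS]mulrA; congr (_ * _); rewrite mulrA; congr (_ * _); field.
apply: (@le_trans _ _ (- (n%:R * (gap / 16) * (l * r2)))); last first.
  by rewrite lerN2 ler_wpM2l// mulr_ge0// divr_ge0// ltW.
have : n%:R * l * gap * eps ^+ 2 <= n%:R * l * gap * r2.
  apply: ler_wpM2l => //; apply: mulr_ge0; last exact: ltW.
  by apply: mulr_ge0 => //; exact: ltW.
by rewrite /q; lra.
Qed.

End direction.

(** * Union bounds and a grid on the sphere *)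

Lemma union_bound (R : realType) (dO : measure_display) (Omega : measurableType dO)
    (P : probability Omega R) (I : Type) (s : seq I) (E : I -> set Omega) (q : R) :
  (forall i, measurable (E i)) -> (forall i, P (E i) <= q%:E)%E ->
  (P (\big[setU/set0]_(i <- s) E i) <= ((size s)%:R * q)%:E)%E.
Proof.
move=> mE Eq; elim: s => [|i s IH]; first by rewrite big_nil measure0 mul0r.
rewrite big_cons; apply: (@le_trans _ _ (P (E i) + P (\big[setU/set0]_(j <- s) E j)))%E.
  by apply: measureU2 => //; apply: bigsetU_measurable => j _.
by rewrite /= -natr1 mulrDl mul1r addrC EFinD; apply: leeD.
Qed.

Lemma union_bound_fin (R : realType) (dO : measure_display) (Omega : measurableType dO)
    (P : probability Omega R) (I : finType) (E : I -> set Omega) (q : R) :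
  (forall i, measurable (E i)) -> (forall i, P (E i) <= q%:E)%E ->
  (P (\bigcup_i E i) <= (#|I|%:R * q)%:E)%E.
Proof.
move=> mE Eq; have := union_bound (index_enum I) mE Eq.
rewrite -bigcup_seq [in X in _ -> X]cardT enumT; congr (is_true (P _ <= _)%E).
by apply/seteqP; split=> w [i _ wi]; exists i => //=; rewrite mem_index_enum.
Qed.

Definition l1norm (R : realType) d (x : 'rV[R]_d) : R := \sum_(j < d) `|x ord0 j|.

Lemma measurable_l1norm (R : realType) d : measurable_fun setT (@l1norm R d).
Proof.
apply: measurable_sum => j; apply: measurableT_comp => //; exact: measurable_coord.
Qed.

Section l1norm_tail.
Context (R : realType) (dO : measure_display) (Omega : measurableType dO)
  (P : probability Omega R) (d : nat).

Lemma l1norm_mgf (X : Omega -> 'rV[R]_d) : measurable_fun setT X ->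
  standard_normal_vector P X ->
  (\int[P]_w (expR (l1norm (X w)))%:E <= (expR (d%:R * (3 / 2)))%:E)%E.
Proof.
move=> mX XN.
have mXj j : measurable_fun setT (fun w => X w ord0 j).
  exact: (measurableT_comp (@measurable_coord R d j) mX).
have mexp : measurable_fun setT (fun x : R => expR `|x|).
  by apply: measurableT_comp => //.
have e32 : 2 * expR (2^-1) <= expR (3 / 2) :> R.
  rewrite (_ : 3 / 2 = 1 + 2^-1 :> R); last by field.
  by rewrite expRD ler_pM2r ?expR_gt0//; have := expR_ge1Dx (1 : R); lra.
have Ej j : exists2 e, has_mean P (fun w => expR `|X w ord0 j|) e & e <= expR (3 / 2).
  have [e he le] := std_normal_expR_abs (std_normal_coord j mX XN) ler01.
  exists e; last first.
    by apply: le_trans le _; rewrite expr1n mul1r.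
  by move: he; rewrite (_ : (fun w => expR (1 * _)) = (fun w => expR `|X w ord0 j|))//;
    apply/funext => w; rewrite mul1r.
under eq_integral do rewrite /l1norm expR_sum.
rewrite (@independent_integral_prod _ _ _ _ _ P _ _ mXj XN.1 (fun _ x => expR `|x|))//.
- have -> : expR (d%:R * (3 / 2)) = \prod_(j < d) expR (3 / 2) :> R.
    by rewrite -expR_sum sumr_const card_ord mulr_natl.
  have [e eE] := choice (fun j => let: ex_intro2 e he le := Ej j in
    ex_intro (fun e => has_mean P (fun w => expR `|X w ord0 j|) e /\ e <= expR (3 / 2)) e (conj he le)).
  under eq_bigr => j _ do rewrite (eE j).1.2.
  rewrite prodEFin lee_fin; apply: ler_prod => j _; rewrite (eE j).2 andbT.
  by apply: has_mean_le (has_mean_cst P 0) (eE j).1 _ => w; exact: expR_ge0.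
- by move=> j; have [e [_ ->] _] := Ej j; rewrite ltry.
Qed.

Context (n : nat) (beta : R) (ts : 'rV[R]_d) (X : 'I_n -> Omega -> 'rV[R]_d)
  (Y : 'I_n -> Omega -> R).
Hypothesis mX : forall i, measurable_fun setT (X i).
Hypothesis mY : forall i, measurable_fun setT (Y i).
Hypothesis XY : logistic_sample P beta ts X Y.

(** exp |x_j| has mean at most 2 exp(1/2) <= exp(3/2), while the threshold allows 3
    per coordinate. *)
Lemma l1norm_sum_tail :
  (P [set w | (n%:R * (3 * d%:R) <= \sum_(i < n) l1norm (X i w))%R] <=
   (expR (- (n%:R * d%:R)))%:E)%E.
Proof.
have mZ i : measurable_fun setT (fun w => (X i w, Y i w)) by exact: measurable_fun_pair.
have mh : measurable_fun setT (fun z : 'rV[R]_d * R => l1norm z.1).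
  exact: measurableT_comp (@measurable_l1norm R d) _.
have hq i : (\int[P]_w (expR (l1norm (X i w)))%:E <= (expR (d%:R * (3 / 2)))%:E)%E.
  by apply: l1norm_mgf => //; case: (XY.2 i).
have := @chernoff_ge _ _ _ _ _ P n _ mZ XY.1 _ _ (n%:R * (3 * d%:R)) mh hq.
move/le_trans; apply; rewrite lee_fin ler_expR.
have : 0 <= n%:R * d%:R :> R by rewrite mulr_ge0.
lra.
Qed.

End l1norm_tail.

Section grid.
Context {R : realType} {d : nat}.
Implicit Types u v x : 'rV[R]_d.

Lemma unit_coord_abs u j : unit_sphere R d u -> `|u ord0 j| <= 1.
Proof.
move=> /unit_sphereE u1; rewrite -(@ler_sqr _ _ 1) ?nnegrE// expr1n real_normK ?num_real//.
rewrite -u1 /dot (bigD1 j)//= -expr2 lerDl.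
by apply: sumr_ge0 => k _; rewrite -expr2 sqr_ge0.
Qed.

(** The coordinates of a unit vector lie in [-1, 1], which is cut into m pieces; the
    right end point 1 falls into a piece of its own, whence m.+1. *)
Definition cell (m : nat) u : {ffun 'I_d -> 'I_m.+1} :=
  [ffun j => inord (Num.truncn ((u ord0 j + 1) * m%:R / 2))].

Lemma cell_eq_dist m u v j : (0 < m)%N -> unit_sphere R d u -> unit_sphere R d v ->
  cell m u = cell m v -> `|u ord0 j - v ord0 j| <= 2 / m%:R.
Proof.
move=> m0 u1 v1 /ffunP/(_ j); rewrite !ffunE.
have mR : 0 < m%:R :> R by rewrite ltr0n.
have range w : unit_sphere R d w -> 0 <= (w ord0 j + 1) * m%:R / 2 <= m%:R.
  move=> /(unit_coord_abs j); rewrite ler_norml => /andP[h1 h2]; apply/andP; split.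
    by rewrite divr_ge0// mulr_ge0//; lra.
  by rewrite ler_pdivrMr// mulrC ler_pM2l//; lra.
have tr w : unit_sphere R d w -> (Num.truncn ((w ord0 j + 1) * m%:R / 2) < m.+1)%N.
  move=> /range/andP[h1 h2]; rewrite truncn_lt_nat//.
  by apply: le_lt_trans h2 _; rewrite ltr_nat.
move=> /(congr1 val) /=; rewrite !inordK ?tr// => e.
have /andP[/truncn_itv/andP[a1 a2] _] := range u u1.
have /andP[/truncn_itv/andP[b1 b2] _] := range v v1.
rewrite e in a1 a2; rewrite -[ltRHS]natr1 in a2; rewrite -[ltRHS]natr1 in b2.
rewrite ler_pdivlMr// -[X in _ * X]ger0_norm// -normrM ler_norml.
by apply/andP; split; lra.
Qed.

Lemma dot_sub_le x u v s : (forall j, `|u ord0 j - v ord0 j| <= s) ->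
  `|dot x u - dot x v| <= l1norm x * s.
Proof.
move=> uv; rewrite /dot /l1norm -sumrB mulr_suml; apply: le_trans (ler_norm_sum _ _ _) _.
by apply: ler_sum => j _; rewrite -mulrBr normrM ler_wpM2l.
Qed.

Lemma excess_lipschitz ts u v x y s : y = 1 \/ y = -1 ->
  (forall j, `|u ord0 j - v ord0 j| <= s) ->
  excess ts v (x, y) - l1norm x * s <= excess ts u (x, y).
Proof.
move=> y1 uv; have := dot_sub_le x uv; rewrite /excess/= ler_norml => /andP[h1 h2].
have relu a b : `|b - a| <= l1norm x * s ->
    Num.max 0 b - l1norm x * s <= Num.max 0 a.
  rewrite ler_norml => /andP[? ?]; have ? : 0 <= l1norm x * s by lra.
  by case: (lerP 0 a) => ?; case: (lerP 0 b) => ?; lra.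
have := relu (- y * dot x u) (- y * dot x v); rewrite ler_norml => H.
have /H : - (l1norm x * s) <= - y * dot x v - - y * dot x u <= l1norm x * s.
  by case: y1 => ->; apply/andP; split; lra.
lra.
Qed.

End grid.

(** * Probability that the minimizer is far *)

Section failure.
Context (R : realType) (dO : measure_display) (Omega : measurableType dO)
  (P : probability Omega R) (d n : nat) (beta : R) (ts : 'rV[R]_d)
  (X : 'I_n -> Omega -> 'rV[R]_d) (Y : 'I_n -> Omega -> R) (hat : Omega -> 'rV[R]_d).
Hypothesis mX : forall i, measurable_fun setT (X i).
Hypothesis mY : forall i, measurable_fun setT (Y i).
Hypothesis mhat : measurable_fun setT hat.
Hypothesis n_gt0 : (0 < n)%N.
Hypothesis beta1 : 1 <= beta.
Hypothesis ts1 : unit_sphere R d ts.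
Hypothesis XY : logistic_sample P beta ts X Y.
Hypothesis hat_min : forall w,
  argmin (unit_sphere R d) (relu_risk (fun i => X i w) (fun i => Y i w)) (hat w).
Notation gap := (signal_gap R).

(** The exponent per observation in excess_sum_le. *)
Definition failure_rate (eps : R) : R :=
  gap ^+ 2 / (noise_const R * 128) / ((beta * eps ^+ 2)^-1 + eps^-1).

Let margin (eps : R) := gap / 16 * eps ^+ 2.

Lemma measurable_enorm_sub : measurable_fun setT (fun w => enorm (hat w - ts)).
Proof.
have mj j : measurable_fun setT (fun w => hat w ord0 j).
  exact: (measurableT_comp (@measurable_coord R d j) mhat).
have msqrt : measurable_fun [set: R] (@Num.sqrt R).
  by apply: nondecreasing_measurable => // x y; exact: ler_wsqrtr.
apply: (measurableT_comp msqrt); apply: measurable_sum => j.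
have mjs : measurable_fun setT (fun w => (hat w - ts) ord0 j).
  rewrite (_ : (fun w => _) = (fun w => hat w ord0 j - ts ord0 j)).
    exact: measurable_funB.
  by apply/funext => w; rewrite !mxE.
exact: measurable_funM.
Qed.

Lemma measurable_far (eps : R) : measurable [set w | eps < enorm (hat w - ts)].
Proof.
rewrite (_ : [set w | _] = (fun w => enorm (hat w - ts)) @^-1` `]eps, +oo[%classic).
  by rewrite -[X in measurable X]setTI; exact: measurable_enorm_sub.
by apply/seteqP; split=> w; rewrite /= in_itv/= andbT.
Qed.

Let hat_unit w : unit_sphere R d (hat w). Proof. by have [] := hat_min w. Qed.

Lemma minimizer_excess_le0 w : \sum_(i < n) excess ts (hat w) (X i w, Y i w) <= 0.
Proof.
have [_ /(_ _ ts1)] := hat_min w.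
rewrite /relu_risk ler_pM2l ?invr_gt0 ?ltr0n// -subr_le0 -sumrB.
by [].
Qed.

Let slow th eps : set Omega :=
  [set w | \sum_(i < n) excess ts th (X i w, Y i w) <= n%:R * margin eps].

Let measurable_slow th eps : measurable (slow th eps).
Proof.
have mS : measurable_fun setT (fun w => \sum_(i < n) excess ts th (X i w, Y i w)).
  apply: measurable_sum => i; apply: (measurableT_comp (measurable_excess ts th)).
  exact: measurable_fun_pair.
rewrite (_ : slow th eps = (fun w => \sum_(i < n) excess ts th (X i w, Y i w)) @^-1`
    `]-oo, n%:R * margin eps]%classic).
  by rewrite -[X in measurable X]setTI; exact: mS.
by apply/seteqP; split=> w; rewrite /slow /= in_itv.
Qed.

Let slow_prob th eps : unit_sphere R d th -> 0 < eps -> eps <= enorm (th - ts) ->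
  (P (slow th eps) <= (expR (- (n%:R * failure_rate eps)))%:E)%E.
Proof.
move=> th1 e0 eth; apply: le_trans (excess_sum_le ts1 beta1 mX mY XY th1 e0 eth) _.
suff -> : n%:R * failure_rate eps = n%:R * (gap ^+ 2 / (noise_const R * 128)) /
  ((beta * eps ^+ 2)^-1 + eps^-1) by [].
by rewrite /failure_rate [LHS]mulrA.
Qed.

Let margin_ge0 eps : 0 <= margin eps.
Proof. by rewrite /margin mulr_ge0 ?sqr_ge0// divr_ge0// ltW// signal_gap_gt0. Qed.

(** Each cell that contains a competitor at distance more than eps is represented by
    one such competitor, hence by a unit vector at distance more than eps.  If the
    l1 norms are under control, a far minimizer forces the representative of its
    cell below the margin. *)
Lemma failure_prob_le (eps : R) (m : nat) : 0 < eps -> (0 < m)%N ->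
  2 / m%:R * (3 * d%:R) <= margin eps ->
  (P [set w | (eps < enorm (hat w - ts))%R] <=
   (m.+1%:R ^+ d * expR (- (n%:R * failure_rate eps)) + expR (- (n%:R * d%:R)))%:E)%E.
Proof.
move=> e0 m0 mmargin.
pose far k th := [/\ unit_sphere R d th, eps < enorm (th - ts) & cell m th = k].
have rep k : exists c, match c with Some th => far k th | None => forall th, ~ far k th end.
  have [[th fth]|nf] := pselect (exists th, far k th); first by exists (Some th).
  by exists None => th fth; apply: nf; exists th.
have [c cP] := choice rep.
pose E k := if c k is Some th then slow th eps else set0.
pose F := [set w | n%:R * (3 * d%:R) <= \sum_(i < n) l1norm (X i w)].
have mE k : measurable (E k) by rewrite /E; case: (c k).
have mF : measurable F.
  have mS : measurable_fun setT (fun w => \sum_(i < n) l1norm (X i w)).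
    by apply: measurable_sum => i; apply: measurableT_comp (mX i); exact: measurable_l1norm.
  rewrite (_ : F = (fun w => \sum_(i < n) l1norm (X i w)) @^-1` `[n%:R * (3 * d%:R), +oo[%classic).
    by rewrite -[X in measurable X]setTI; exact: mS.
  by apply/seteqP; split=> w; rewrite /F /= in_itv/= andbT.
have mUE : measurable (\bigcup_k E k).
  by apply: fin_bigcup_measurable => //; exact: finite_finset.
apply: (@le_trans _ _ (P ((\bigcup_k E k) `|` F))).
  apply: le_measure; rewrite ?inE; [exact: measurable_far|exact: measurableU|].
  move=> w /= far_w; have [Fw|nFw] := pselect (F w); [by right|left].
  exists (cell m (hat w)) => //; rewrite /E.
  have := cP (cell m (hat w)); case: (c _) => [th [th1 fth ceq]|/(_ (hat w))]; last first.
    by case; split.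
  have small : \sum_(i < n) l1norm (X i w) <= n%:R * (3 * d%:R).
    by rewrite leNgt; apply/negP => /ltW.
  have m2 : 0 <= 2 / m%:R :> R by rewrite divr_ge0.
  rewrite /slow /=.
  apply: (@le_trans _ _ (\sum_(i < n) (excess ts (hat w) (X i w, Y i w) + l1norm (X i w) * (2 / m%:R)))).
    apply: ler_sum => i _; rewrite -lerBlDr; apply: excess_lipschitz.
      by have [_ + _] := XY.2 i; apply.
    by move=> j; apply: cell_eq_dist.
  rewrite big_split/= -mulr_suml -[leRHS]add0r; apply: lerD; first exact: minimizer_excess_le0.
  apply: (@le_trans _ _ (n%:R * (3 * d%:R) * (2 / m%:R))); first by rewrite ler_wpM2r.
  by rewrite -mulrA ler_wpM2l// mulrC.
apply: (@le_trans _ _ (P (\bigcup_k E k) + P F)%E); first exact: measureU2.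
rewrite EFinD; apply: leeD; last exact: (l1norm_sum_tail mX mY XY).
have -> : m.+1%:R ^+ d = #|{ffun 'I_d -> 'I_m.+1}|%:R :> R.
  by rewrite card_ffun !card_ord natrX.
apply: union_bound_fin => // k; rewrite /E; have := cP k; case: (c k) => [th [th1 fth _]|_].
  by apply: slow_prob => //; exact: ltW.
by rewrite measure0 lee_fin expR_ge0.
Qed.

(** On the line the unit sphere is {theta_star, - theta_star}, so a single Chernoff
    bound, without any factor in front, is enough. *)
Lemma failure_prob_le_dim1 (eps : R) : d = 1%N -> 0 < eps -> eps <= 2 ->
  (P [set w | (eps < enorm (hat w - ts))%R] <= (expR (- (n%:R * failure_rate eps)))%:E)%E.
Proof.
move=> d1 e0 e2.
have Nts1 : unit_sphere R d (- ts).
  rewrite /unit_sphere/= -[RHS]ts1 /enorm; congr Num.sqrt.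
  by apply: eq_bigr => j _; rewrite !mxE mulrNN.
have eN : eps <= enorm (- ts - ts).
  rewrite (enorm_sub_unit ts1 Nts1) (_ : 2 * _ = 2 ^+ 2).
    by rewrite sqrtr_sqr ger0_norm.
  rewrite (_ : dot ts (- ts) = - 1); first by ring.
  rewrite -(unit_sphereE ts1) /dot -sumrN; apply: eq_bigr => j _.
  by rewrite !mxE mulrN.
apply: le_trans (slow_prob Nts1 e0 eN).
apply: le_measure; rewrite ?inE; [exact: measurable_far|exact: measurable_slow|].
move=> w /= far_w; rewrite /slow/=.
have -> : - ts = hat w.
  have ord_eq : forall k j : 'I_d, k = j by rewrite d1 => k j; rewrite !ord1.
  have /unit_sphereE hu := hat_unit w; have /unit_sphereE tu := ts1.
  have dot1 (u : 'rV[R]_d) : dot u u = 1 -> forall j, u ord0 j = 1 \/ u ord0 j = -1.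
    move=> + j; rewrite /dot (bigD1 j)//= big1 ?addr0.
      by move/eqP; rewrite -expr2 sqrf_eq1 => /orP[/eqP|/eqP]; [left|right].
    by move=> k; rewrite (ord_eq k j) eqxx.
  have sub (u v : 'rV[R]_d) j : u ord0 j = v ord0 j -> u = v.
    by move=> uv; apply/rowP => k; rewrite (ord_eq k j).
  have j0 : 'I_d by rewrite d1; exact: ord0.
  have ne : hat w ord0 j0 <> ts ord0 j0.
    move=> /sub ht; move: far_w; rewrite ht subrr /enorm /dot big1 ?sqrtr0.
      by rewrite ltNge ltW.
    by move=> j _; rewrite mxE mul0r.
  apply: (sub _ _ j0); rewrite mxE.
  by case: (dot1 _ hu j0) ne => ->; case: (dot1 _ tu j0) => -> //; rewrite ?opprK.
apply: le_trans (minimizer_excess_le0 w) _.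
by rewrite mulr_ge0.
Qed.

End failure.

(** * Sample size *)

Section sample_size.
Context {R : realType}.
Notation gap := (signal_gap R).
Implicit Types (eps delta beta : R).

Definition rate_const : R := gap ^+ 2 / (noise_const R * 128).
(** Chosen so that ln (98 / signal_gap) <= net_const * ln (d / eps) for d >= 2. *)
Definition net_const : R := ln (98 / gap) / ln 2.
Definition sample_const : R := (net_const + 3) / rate_const.

Lemma rate_const_bounds : 0 < rate_const <= 1.
Proof.
have g0 := @signal_gap_gt0 R; have g1 := @signal_gap_le1 R; have K1 := noise_const_ge1 R.
have K0 : 0 < noise_const R * 128 by lra.
rewrite /rate_const divr_gt0 ?exprn_gt0//= ler_pdivrMr// mul1r.
by apply: (@le_trans _ _ 1); [rewrite expr_le1// ltW|lra].
Qed.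

Lemma ln2_gt0 : 0 < ln 2 :> R.
Proof. by rewrite ln_gt0// ltr1n. Qed.

Lemma net_const_ge0 : 0 <= net_const.
Proof.
have g0 := @signal_gap_gt0 R; have g1 := @signal_gap_le1 R.
rewrite /net_const divr_ge0 ?(ltW ln2_gt0)// ln_ge0// ler_pdivlMr//; lra.
Qed.

Lemma sample_const_ge1 : 1 <= sample_const.
Proof.
have /andP[k0 k1] := rate_const_bounds; have := net_const_ge0.
by move=> h; rewrite /sample_const ler_pdivlMr//; lra.
Qed.

Variables (d n : nat) (beta eps delta : R).
Hypothesis d_gt0 : (0 < d)%N.
Hypothesis beta1 : 1 <= beta.
Hypothesis eps01 : 0 < eps < 1.
Hypothesis delta01 : 0 < delta < 1.
Let E := (beta * eps ^+ 2)^-1 + eps^-1.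
Let ell := ln (d%:R / eps).
Let L := d%:R * ell + ln (1 / delta).
Hypothesis n_large : sample_const * (L / (beta * eps ^+ 2) + L / eps) <= n%:R.

Let eps0 : 0 < eps. Proof. by case/andP: eps01. Qed.
Let eps1 : eps < 1. Proof. by case/andP: eps01. Qed.
Let delta0 : 0 < delta. Proof. by case/andP: delta01. Qed.
Let d1 : 1 <= d%:R :> R. Proof. by rewrite ler1n. Qed.

Let E_ge1 : 1 <= E.
Proof.
have b0 : 0 < beta by apply: lt_le_trans beta1.
have h1 : 0 < (beta * eps ^+ 2)^-1 by rewrite invr_gt0 mulr_gt0// exprn_gt0.
have h2 : 1 <= eps^-1 by rewrite invf_ge1// ltW.
rewrite /E; lra.
Qed.

Let ell_ge0 : 0 <= ell.
Proof. by rewrite /ell ln_ge0// ler_pdivlMr// mul1r (le_trans (ltW eps1)). Qed.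

Let lnd_ge0 : 0 <= ln (1 / delta).
Proof. by rewrite ln_ge0// ler_pdivlMr// mul1r ltW//; case/andP: delta01. Qed.

Let L_ge0 : 0 <= L.
Proof. by rewrite /L addr_ge0// mulr_ge0. Qed.

Let expRNlnd : expR (- ln (1 / delta)) = delta.
Proof. by rewrite div1r lnV ?posrE// opprK lnK. Qed.

Let n_ge : sample_const * (L * E) <= n%:R.
Proof. by rewrite /E mulrDr. Qed.

Let rate_ge : (net_const + 3) * L <= n%:R * failure_rate beta eps.
Proof.
have /andP[k0 _] := rate_const_bounds.
have E0 : 0 < E by apply: lt_le_trans E_ge1.
have -> : n%:R * failure_rate beta eps = n%:R * rate_const / E.
  by rewrite /failure_rate -/rate_const -/E mulrA.
rewrite ler_pdivlMr//; move: n_ge; rewrite /sample_const mulrAC ler_pdivrMr//.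
by rewrite mulrA.
Qed.

Lemma failure_le_dim1 : expR (- (n%:R * failure_rate beta eps)) <= delta.
Proof.
rewrite -[leRHS]expRNlnd ler_expR lerN2; apply: le_trans rate_ge.
have h : 0 <= net_const * L by rewrite mulr_ge0// net_const_ge0.
have h2 : 0 <= d%:R * ell by rewrite mulr_ge0.
have h3 := L_ge0.
have : ln (1 / delta) <= L by rewrite /L lerDr.
lra.
Qed.

(** The oscillation 2 / mesh * 3 d over a cell has to stay below the margin
    signal_gap * eps^2 / 16, and 96 = 2 * 3 * 16. *)
Definition mesh : nat := (Num.truncn (96 * d%:R / (gap * eps ^+ 2))).+1.

Let g0 : 0 < gap := signal_gap_gt0.
Let ge0 : 0 < gap * eps ^+ 2. Proof. by rewrite mulr_gt0// exprn_gt0. Qed.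

Lemma mesh_fine : 2 / mesh%:R * (3 * d%:R) <= gap / 16 * eps ^+ 2.
Proof.
have m0 : 0 < mesh%:R :> R by rewrite ltr0n.
have : 96 * d%:R / (gap * eps ^+ 2) < mesh%:R.
  exact: truncnS_gt.
rewrite ltr_pdivrMr// => h.
rewrite mulrAC ler_pdivrMr//; lra.
Qed.

Let mesh_le : mesh.+1%:R <= 98 / gap * (d%:R / eps) ^+ 2.
Proof.
have q1 : 1 <= d%:R / (gap * eps ^+ 2).
  have e2 : eps ^+ 2 <= 1 by rewrite expr_le1// ltW.
  rewrite ler_pdivlMr// mul1r; apply: le_trans d1; apply: le_trans e2.
  by apply: ler_piMl; [exact: sqr_ge0|exact: signal_gap_le1].
have t0 : 0 <= 96 * d%:R / (gap * eps ^+ 2) by rewrite -mulrA; lra.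
have /andP[t1 _] := truncn_itv t0.
have -> : mesh.+1%:R = (Num.truncn (96 * d%:R / (gap * eps ^+ 2)))%:R + 2 :> R.
  by rewrite /mesh -addn2 natrD.
apply: (@le_trans _ _ (98 * (d%:R / (gap * eps ^+ 2)))).
  move: t1; rewrite -mulrA; lra.
have -> : 98 / gap * (d%:R / eps) ^+ 2 = 98 * (d%:R * (d%:R / (gap * eps ^+ 2))).
  by field; rewrite !gt_eqF.
by rewrite ler_pM2l// ler_peMl// (le_trans ler01).
Qed.

(** Both terms are at most delta / 2.  The sample size exceeds net_const + 3 times
    d ln (d / eps) + ln (1 / delta), up to the rate: net_const + 2 of these pay for
    the number of cells, since ln (mesh + 1) <= ln (98 / signal_gap) + 2 ln (d / eps),
    and the last one for ln 2 and ln (1 / delta). *)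
Lemma failure_le : (1 < d)%N ->
  mesh.+1%:R ^+ d * expR (- (n%:R * failure_rate beta eps)) + expR (- (n%:R * d%:R)) <= delta.
Proof.
move=> d2; have d2R : 2 <= d%:R :> R by rewrite ler_nat.
have ln2 := ln2_gt0; have ell2 : ln 2 <= ell.
  rewrite /ell ler_ln ?posrE ?divr_gt0//; last by lra.
  by rewrite ler_pdivlMr//; have := eps1; lra.
have dell : ell <= d%:R * ell by rewrite ler_peMl.
have LL : ln 2 + ln (1 / delta) <= L by rewrite /L lerD2r (le_trans ell2).
have half : expR (- (ln 2 + ln (1 / delta))) = delta / 2.
  by rewrite opprD expRD expRNlnd expRN lnK ?posrE// mulrC.
have lnm : ln mesh.+1%:R <= (net_const + 2) * ell.
  have q0 : 0 < d%:R / eps by rewrite divr_gt0//; lra.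
  have gap_inv : 0 < 98 / gap by rewrite divr_gt0.
  have sq0 : 0 < (d%:R / eps) ^+ 2 by rewrite exprn_gt0.
  apply: (@le_trans _ _ (ln (98 / gap * (d%:R / eps) ^+ 2))).
    have mesh0 : 0 < mesh.+1%:R :> R by rewrite ltr0n.
    by rewrite ler_ln ?posrE// mulr_gt0.
  rewrite lnM ?posrE// lnXn//.
  have -> : ln (98 / gap) = net_const * ln 2 by rewrite /net_const divfK// gt_eqF.
  have := ler_wpM2l net_const_ge0 ell2.
  by rewrite -/ell mulrDl mulr2n; lra.
have h1 : mesh.+1%:R ^+ d * expR (- (n%:R * failure_rate beta eps)) <= delta / 2.
  have -> : mesh.+1%:R ^+ d = expR (d%:R * ln mesh.+1%:R) :> R.
    by rewrite mulr_natl -lnXn// lnK// posrE exprn_gt0.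
  rewrite -expRD -half ler_expR.
  have r1 := rate_ge.
  have r2 : d%:R * ln mesh.+1%:R <= d%:R * ((net_const + 2) * ell) by rewrite ler_wpM2l.
  have r3 : 0 <= net_const * ln (1 / delta) by rewrite mulr_ge0// net_const_ge0.
  have r4 := lnd_ge0.
  have r5 : ln 2 <= d%:R * ell by apply: le_trans dell.
  have r6 : (net_const + 3) * L = d%:R * ((net_const + 2) * ell) + d%:R * ell +
     net_const * ln (1 / delta) + 3 * ln (1 / delta) by rewrite /L; ring.
  lra.
have h2 : expR (- (n%:R * d%:R)) <= delta / 2.
  rewrite -half ler_expR lerN2; apply: (le_trans LL).
  apply: (@le_trans _ _ n%:R); last by rewrite ler_peMr.
  apply: le_trans n_ge; rewrite -[leLHS]mul1r ler_pM//.
    exact: sample_const_ge1.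
  by rewrite ler_peMr.
lra.
Qed.

End sample_size.

Theorem theorem3 (R : realType) (c : R) (hc : 0 < c) :
  exists2 C : R, 0 < C &
  forall (d n : nat) (beta : R) (theta_star : 'rV[R]_d) (eps delta : R)
    (dO : measure_display) (Omega : measurableType dO)
    (P : probability Omega R)
    (X : 'I_n -> {RV P >-> 'rV[R]_d}) (Y : 'I_n -> {RV P >-> R})
    (theta_hat : {RV P >-> 'rV[R]_d}),
    (1 <= d)%N -> (1 <= n)%N ->
    1 + c <= beta ->
    unit_sphere R d theta_star ->
    0 < eps < 1 -> 0 < delta < 1 ->
    logistic_sample P beta theta_star (fun i w => X i w) (fun i w => Y i w) ->
    (forall w : Omega,
      argmin (unit_sphere R d)
        (relu_risk (fun i => X i w) (fun i => Y i w)) (theta_hat w)) ->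
    C * ((d%:R * ln (d%:R / eps) + ln (1 / delta)) / (beta * eps ^+ 2)
         + (d%:R * ln (d%:R / eps) + ln (1 / delta)) / eps) <= n%:R ->
    ((1 - delta)%:E <= P [set w | enorm (theta_hat w - theta_star) <= eps]%R)%E.
Proof.
exists sample_const; first exact: lt_le_trans sample_const_ge1.
move=> d n beta ts eps delta dO Omega P X Y hat d0 n0 betac ts1 eps01 delta01 XY hat_min n_large.
have beta1 : 1 <= beta by lra.
have /andP[e0 e1] := eps01.
have mX i : measurable_fun setT (X i : Omega -> 'rV[R]_d) by [].
have mY i : measurable_fun setT (Y i : Omega -> R) by [].
have mhat : measurable_fun setT (hat : Omega -> 'rV[R]_d) by [].
have mfar := measurable_far ts mhat eps.
suff far_le : (P [set w | (eps < enorm (hat w - ts))%R] <= delta%:E)%E.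
  rewrite (_ : [set w | _] = ~` [set w | eps < enorm (hat w - ts)]); last first.
    by apply/seteqP; split=> w /=; [move=> h; apply/negP; rewrite -leNgt|move=> /negP; rewrite -leNgt].
  by rewrite probability_setC// EFinB leeB.
have [d2|d1] := ltnP 1 d.
  apply: le_trans (failure_prob_le mX mY mhat n0 beta1 ts1 XY hat_min e0 (ltn0Sn _)
    (mesh_fine d eps01)) _.
  by rewrite lee_fin; apply: failure_le.
have {}d1 : d = 1%N by apply/eqP; rewrite eqn_leq d1.
apply: le_trans (failure_prob_le_dim1 mX mY mhat n0 beta1 ts1 XY hat_min d1 e0 _) _.
  lra.
by rewrite lee_fin; apply: failure_le_dim1 n_large.
Qed.
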